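(* Let $\mathcal{S}$ be a finite connected poset of Class Y, and let $\mathcal{A}$ be a finite connected poset. Then monotonicity equivalence holds for $(\mathcal{A},\mathcal{S})$ if and only if there exists an acyclic (finite) poset $\tilde{\mathcal{A}}$ which has $\mathcal{A}$ as an induced subposet.
   Context: All posets are finite. For a poset $\mathcal{S}$ with ground set $S$: $y$ covers $x$ if $x<y$ and no $z\in S$ satisfies $x<z<y$. The cover graph of $\mathcal{S}$ is the undirected graph on $S$ whose edges are the pairs $\{x,y\}$ such that one of $x,y$ covers the other. $\mathcal{S}$ is connected if its cover graph is connected; it has a cycle if its cover graph contains a cycle (in the usual graph-theoretic sense), and it is acyclic otherwise. An induced subposet of $\mathcal{S}$ is a subset of $S$ with the restricted order (and, by extension, any poset isomorphic to such); ''$\mathcal{S}$ has an induced $\mathcal{Q}$'' means some induced subposet of $\mathcal{S}$ is isomorphic to $\mathcal{Q}$. The bowtie is the poset on four elements $x_0,x_1,y_0,y_1$ whose only strict relations are $x_i<y_j$ for all $i,j\in\{0,1\}$. A Y-poset is the poset on four elements $x,y,z,w$ with cover relations $x<z$, $y<z$, $z<w$ (so $x,y$ are incomparable, both below $z$, and $z$ is below $w$), or the dual of this poset (all order relations reversed). A connected poset $\mathcal{S}$ is in Class B if $\mathcal{S}$ has either a cycle or an induced bowtie. A connected poset $\mathcal{S}$ is in Class Y if $\mathcal{S}$ is not in Class B and $\mathcal{S}$ has an induced Y-poset. An up-set of $\mathcal{S}$ is a set $U\subseteq S$ such that $x\in U$ and $x\le y$ imply $y\in U$. For probability measures $P_1,P_2$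 on $S$, write $P_1\preceq P_2$ if $P_1(U)\le P_2(U)$ for every up-set $U$ of $\mathcal{S}$. Let $\mathcal{A}$ (ground set $A$) and $\mathcal{S}$ (ground set $S$) be finite posets and let $(P_\alpha:\alpha\in A)$ be a system of probability measures on $S$. The system is stochastically monotone if $P_\alpha\preceq P_\beta$ whenever $\alpha\le\beta$ in $\mathcal{A}$. It is realizably monotone if there exist $S$-valued random variables $(\mathbf{X}_\alpha:\alpha\in A)$ on a common probability space such that $\mathbf{X}_\alpha\le\mathbf{X}_\beta$ in $\mathcal{S}$ whenever $\alpha\le\beta$ in $\mathcal{A}$, and $\mathbf{X}_\alpha$ has distribution $P_\alpha$ for every $\alpha\in A$. Monotonicity equivalence holds for $(\mathcal{A},\mathcal{S})$ if every stochastically monotone system $(P_\alpha:\alpha\in A)$ of probability measures on $S$ is realizably monotone. *)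

(* Defs.v *)
From HB Require Import structures.
From mathcomp Require Import all_boot all_order all_algebra.
From mathcomp Require Import all_classical all_reals all_analysis.
From mathcomp Require Import zify.

Set Implicit Arguments.
Unset Strict Implicit.
Unset Printing Implicit Defensive.

Import Order.TTheory GRing.Theory Num.Theory.

Local Open Scope order_scope.

Section CoverGraph.
Context {d : Order.disp_t} (T : finPOrderType d).

Definition covers (y x : T) : bool := (x < y) && ~~ [exists z, x < z < y].

Definition cover_adj : rel T := [rel x y | covers x y || covers y x].

(* The empty poset counts as connected. *)
Definition connected_poset : Prop := forall x y : T, connect cover_adj x y.

(* [ucycle] is a closed walk through pairwise distinct vertices; the bound on
   the length excludes the degenerate 2-cycle that goes back and forth along a
   single edge. *)
Definition has_cycle : Prop :=
  exists c : seq T, (2 < size c)%N /\ ucycle cover_adj c.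

Definition acyclic_poset : Prop := ~ has_cycle.

End CoverGraph.

Definition has_induced {d d' : Order.disp_t}
    (S : finPOrderType d) (Q : finPOrderType d') : Prop :=
  exists (U : {set S}) (f : Q -> {x : S | x \in U}),
    bijective f /\ forall p q : Q, (val (f p) <= val (f q)) = (p <= q).

(* x_0, x_1, y_0, y_1 are encoded as 0, 1, 2, 3. *)
Definition bowtie : Type := 'I_4.
HB.instance Definition _ := Finite.on bowtie.

Definition bowtie_le : rel bowtie :=
  [rel p q : 'I_4 | (p == q) || ((p < 2)%N && (2 <= q)%N)].

Lemma bowtie_le_refl : reflexive bowtie_le.
Proof. by move=> p; rewrite /bowtie_le /= eqxx. Qed.

Lemma bowtie_le_anti : antisymmetric bowtie_le.
Proof.
case=> p lt_p4 [q lt_q4]; rewrite /bowtie_le /= -!val_eqE /= => le_pq.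
by apply/val_inj => /=; lia.
Qed.

Lemma bowtie_le_trans : transitive bowtie_le.
Proof.
by case=> q lt_q4 [p lt_p4] [r lt_r4]; rewrite /bowtie_le /= -!val_eqE /=; lia.
Qed.

HB.instance Definition _ := Order.Le_isPOrder.Build Order.default_display bowtie
  bowtie_le_refl bowtie_le_anti bowtie_le_trans.

(* x, y, z, w are encoded as 0, 1, 2, 3. *)
Definition Yposet : Type := 'I_4.
HB.instance Definition _ := Finite.on Yposet.

Definition Yposet_le : rel Yposet :=
  [rel p q : 'I_4 | (p == q) || ((p < q)%N && (2 <= q)%N)].

Lemma Yposet_le_refl : reflexive Yposet_le.
Proof. by move=> p; rewrite /Yposet_le /= eqxx. Qed.

Lemma Yposet_le_anti : antisymmetric Yposet_le.
Proof.
case=> p lt_p4 [q lt_q4]; rewrite /Yposet_le /= -!val_eqE /= => le_pq.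
by apply/val_inj => /=; lia.
Qed.

Lemma Yposet_le_trans : transitive Yposet_le.
Proof.
by case=> q lt_q4 [p lt_p4] [r lt_r4]; rewrite /Yposet_le /= -!val_eqE /=; lia.
Qed.

HB.instance Definition _ := Order.Le_isPOrder.Build Order.default_display Yposet
  Yposet_le_refl Yposet_le_anti Yposet_le_trans.

Definition has_induced_Y {d : Order.disp_t} (S : finPOrderType d) : Prop :=
  has_induced S Yposet \/ has_induced S (Yposet^d)%type.

Definition class_B {d : Order.disp_t} (S : finPOrderType d) : Prop :=
  connected_poset S /\ (has_cycle S \/ has_induced S bowtie).

Definition class_Y {d : Order.disp_t} (S : finPOrderType d) : Prop :=
  [/\ connected_poset S, ~ class_B S & has_induced_Y S].

(* [T] with the sigma-algebra of all its subsets. The point [x0] only serves to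
   meet the requirement of the library that measurable types be pointed. *)
Definition discrete {T : choiceType} (x0 : T) : Type := T.

Section Discrete.
Context {T : choiceType} (x0 : T).

HB.instance Definition _ := Choice.on (discrete x0).
HB.instance Definition _ := isPointed.Build (discrete x0) x0.
HB.instance Definition _ := @isMeasurable.Build default_measure_display
  (discrete x0) (@discrete_measurable (discrete x0)) (@discrete_measurable0 _)
  (@discrete_measurableC _) (@discrete_measurableU _).

End Discrete.

Section Monotonicity.
Context {d : Order.disp_t} {S : finPOrderType d} {R : realType}.

Definition up_set (U : set S) : Prop := forall x y : S, U x -> x <= y -> U y.

Definition stoch_le {x0 : S} (P1 P2 : probability (discrete x0) R) : Prop :=
  forall U : set S, up_set U -> (P1 U <= P2 U)%E.

Context {d' : Order.disp_t} {A : finPOrderType d'} {x0 : S}.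
Variable P : A -> probability (discrete x0) R.

Definition stochastically_monotone : Prop :=
  forall a b : A, a <= b -> stoch_le (P a) (P b).

Definition realizably_monotone : Prop :=
  exists (dO : measure_display) (Omega : measurableType dO)
         (Pr : probability Omega R) (X : A -> {RV Pr >-> discrete x0}),
    (forall a b : A, a <= b -> forall w : Omega, (X a w : S) <= (X b w : S)) /\
    (forall a : A, distribution Pr (X a) =1 P a).

End Monotonicity.

(* If [S] is empty it carries no probability measure, so the only system is the
   one indexed by the empty poset, which is realizably monotone: quantifying
   over the base point [x0] loses nothing. *)
Definition monotonicity_equivalence (R : realType) {d d' : Order.disp_t}
    (A : finPOrderType d) (S : finPOrderType d') : Prop :=
  forall (x0 : S) (P : A -> probability (discrete x0) R),
    stochastically_monotone P -> realizably_monotone P.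

(* Main.v *)
(* Suppose that A has an acyclic extension. Since the cover graph of S is a tree,
   deleting a cover edge splits S into two parts, the upper one an up-set, and
   stochastic order is the coordinatewise order of the masses of these up-sets;
   as S has no bowtie, finite families of measures interpolate in this order.
   Hence a stochastically monotone system on A extends to the convex hull of A in
   its acyclic extension. Along each cover edge there is a monotone kernel, and
   these are glued one edge at a time, as every edge joins two components.

   Conversely, if A has no acyclic extension, then its Dedekind-MacNeille
   completion (without trivial cuts) has a cycle in its cover graph. A shortest
   path closing a cover edge u < v of the completion then yields a cycle of
   comparabilities in A on which measures uniform on two points of a Y-poset
   force a fair coin to differ from itself. *)

Require Import Defs.
From HB Require Import structures.
From mathcomp Require Import all_boot all_order all_algebra.
From mathcomp Require Import all_classical all_reals all_analysis.
From mathcomp Require Import zify ring lra.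

Set Implicit Arguments.
Unset Strict Implicit.
Unset Printing Implicit Defensive.

Import Order.TTheory.

Local Open Scope order_scope.

(** * Cover graphs *)

(** A cycle in the cover graph of [A] is not yet an obstacle: a bowtie has one, and a point inserted
    in its middle removes it. So cycles are looked for in a completion that has all such midpoints,
    and what is brought back to [A] is a pair of arcs with no comparability from one to the other.
    Points of the completion outside [A] are handled by density: each can be traded for elements of
    [A] just under or just over it. On a tree, a function of total mass zero is the same as a flow
    on the cover edges. The edge masses of an interpolating measure can therefore be chosen at will
    between their bounds, and only nonnegativity at the vertices remains. Without bowties a vertex
    has at most one lower cover or at most one upper cover, and taking an extreme admissible mass on
    that single edge settles the vertex. Since an edge serves two vertices, the choices have to
    agree; this is why the dichotomy asks for a fork anywhere above a vertex, not only at it. *)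

Section Embedding.
Context {d d' : Order.disp_t} (S : finPOrderType d) (Q : finPOrderType d').

Lemma embedding_has_induced (g : Q -> S) :
  (forall p q, (g p <= g q) = (p <= q)) -> has_induced S Q.
Proof.
move=> g_mono; have g_inj : injective g.
  by move=> p q eq_g; apply: le_anti; rewrite -!g_mono eq_g lexx.
have gP p : g p \in [set g q | q : Q] by apply/imsetP; exists p.
exists [set g q | q : Q], (fun p => exist _ (g p) (gP p)); split=> //.
have preim (u : {x : S | x \in [set g q | q : Q]}) : {q | val u = g q}.
  by apply: cid; case: u => s /= /imsetP[q _ ->]; exists q.
exists (fun u => sval (preim u)) => [p|u].
  by apply: g_inj; case: (preim _).
by apply: val_inj; case: (preim _).
Qed.

Lemma has_induced_embedding :
  has_induced S Q -> exists g : Q -> S, forall p q, (g p <= g q) = (p <= q).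
Proof. by case=> U [f [_ f_mono]]; exists (fun p => val (f p)). Qed.

End Embedding.

Section Covers.
Context {d : Order.disp_t} {T : finPOrderType d}.
Implicit Types x y z : T.

Lemma covers_lt x y : covers y x -> x < y.
Proof. by case/andP. Qed.

Lemma covers_between x y z : covers y x -> x <= z -> z <= y -> z = x \/ z = y.
Proof.
case/andP=> _ /existsPn noz; rewrite !le_eqVlt.
case/predU1P=> [->|xz]; first by left.
case/predU1P=> [->|zy]; first by right.
by move: (noz z); rewrite xz zy.
Qed.

Lemma cover_adj_sym : symmetric (@cover_adj d T).
Proof. by move=> x y; rewrite /cover_adj /= orbC. Qed.

Lemma cover_adj_neq x y : cover_adj x y -> x != y.
Proof. by case/orP=> /covers_lt /lt_eqF; [rewrite eq_sym|] => ->. Qed.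

(** Splitting at an intermediate point leaves fewer points strictly between. Only covers inside the
    interval are asked for, since the realization will be ordered only along covers within the
    convex hull of [A]. *)
Lemma cover_chain_ind (r : T -> T -> Prop) x y :
    (forall z, r z z) -> (forall u v w, r u v -> r v w -> r u w) ->
    (forall u v, x <= u -> v <= y -> covers v u -> r u v) ->
  x <= y -> r x y.
Proof.
move=> r_refl r_trans r_cov.
have [n] := ubnP #|[set z | (x < z < y)%O]|.
elim: n x y r_cov => // n IHn x y r_cov lt_n; rewrite le_eqVlt.
case/predU1P=> [->//|xy].
have [cov|] := boolP (covers y x); first exact: r_cov.
rewrite /covers xy negbK => /existsP[z /andP[xz zy]].
have sub u v : (x <= u) -> (v <= y) -> z \in [set t | x < t < y] ->
    ~~ (u < z < v) -> (#|[set t | (u < t < v)%O]| < n)%N.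
  move=> xu vy zin znot; rewrite -ltnS; apply: leq_ltn_trans lt_n.
  apply: proper_card; apply/fintype.properP; split.
    apply/fintype.subsetP=> t; rewrite !inE => /andP[ut tv].
    by rewrite (le_lt_trans xu ut) (lt_le_trans tv vy).
  by exists z => //; rewrite inE.
have zin : z \in [set t | x < t < y] by rewrite inE xz zy.
apply: (r_trans _ z).
  apply: IHn; last exact: ltW.
    by move=> u v xu vz; apply: r_cov => //; apply: le_trans vz (ltW zy).
  by apply: sub => //; [exact: ltW|rewrite ltxx andbF].
apply: IHn; last exact: ltW.
  by move=> u v zu vy; apply: r_cov => //; apply: le_trans (ltW xz) zu.
by apply: sub => //; [exact: ltW|rewrite ltxx].
Qed.

(** A simple [e]-path from [x] to [y] has an inner vertex, so the edge closes it to a cycle. The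
    relation [e] is left general: it will be the cover graph minus one edge, and later a partly
    built forest. *)
Lemma acyclic_bridge (e : rel T) x y : acyclic_poset T -> cover_adj x y ->
  (forall u v, e u v -> cover_adj u v) -> ~~ e x y -> ~~ connect e x y.
Proof.
move=> acyc xy sub_e nexy; apply/negP => /connectP[p]; case/shortenP=> q e_q uq _ def_y.
apply: acyc; exists (x :: q); split.
  case: q e_q uq def_y => [|z [|//]] /=.
    by move=> _ _ eq_yx; move: (cover_adj_neq xy); rewrite eq_yx eqxx.
  by rewrite andbT => e_xz _ eq_yz; rewrite eq_yz e_xz in nexy.
rewrite /ucycle uq andbT /= rcons_path -def_y cover_adj_sym xy andbT.
exact: sub_path e_q.
Qed.

Lemma cycle_bypass : has_cycle T -> exists x y, covers y x /\
  connect [rel u v | cover_adj u v &&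
                     ~~ ((u == x) && (v == y) || (u == y) && (v == x))] x y.
Proof.
case=> [[|x [|y p]]] [] //= sz_p /andP[/andP[xy]].
rewrite -[X in is_true X -> _]/(path (@cover_adj d T) y (rcons p x)) rcons_path /=.
move=> /andP[path_p last_p] /andP[].
rewrite inE negb_or => /andP[xny xnp] /andP[ynp up].
pose e x y := [rel u v : T | cover_adj u v &&
                     ~~ ((u == x) && (v == y) || (u == y) && (v == x))].
have e_sym u v : connect_sym (e u v).
  apply: sym_connect_sym => a b; rewrite /e /= (@cover_adj_sym a); congr (_ && ~~ _).
  by rewrite orbC; congr (_ || _); rewrite andbC.
suff bypass : connect (e x y) x y.
  case/orP: xy => cov; last by exists x, y.
  exists y, x; split=> //; rewrite (e_sym y x).
  rewrite (eq_connect (e' := e x y)) // => a b.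
  by rewrite /e /= orbC.
rewrite e_sym.
apply: (connect_trans (y := last y p)); last first.
  apply: connect1; rewrite /e /= last_p eqxx andbT (negPf xny) andbF /=.
  case: p sz_p ynp {path_p last_p xnp up} => //= z p _ ynzp.
  by apply: contraNneq ynzp => <-; apply: mem_last.
apply/connectP; exists p => //.
have {}xnp : x \notin y :: p by rewrite inE negb_or xny.
apply: (sub_in_path (P := mem (y :: p))) path_p; last exact/allP.
move=> a b a_in b_in ab; rewrite /e /= ab /=.
have nx c : c \in y :: p -> c == x = false by move=> c_in; apply: contraNF xnp => /eqP <-.
by rewrite !nx // andbF.
Qed.

End Covers.

(** * Obstructions to acyclic extensions *)

Section Obstruction.
Context {A : Type} (le : rel A).

(* Connectedness of [L] in the comparability graph, as an induction principle. *)
Definition linked (L : A -> Prop) : Prop := forall Z : A -> Prop,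
  (forall a b, L a -> L b -> le a b || le b a -> Z a -> Z b) ->
  forall a b, L a -> L b -> Z a -> Z b.

Definition apart (L R : A -> Prop) : Prop :=
  forall l r, L l -> R r -> ~~ le l r /\ ~~ le r l.

Definition spans (b t : A) (L : A -> Prop) : Prop :=
  [/\ linked L, exists2 l, L l & le b l, exists2 l, L l & le l t
    & forall l, L l -> ~~ le l b /\ ~~ le t l].

(* A cycle of comparabilities through a low point [b] and a high point [t] whose
   two arcs [L] and [R] are nowhere comparable, so that no bowtie midpoint can
   merge them. *)
Definition obstruction : Prop := exists (b t : A) (L R : A -> Prop),
  [/\ apart L R, spans b t L & spans b t R].

End Obstruction.

Lemma obstruction_flip {A : Type} (le : rel A) :
  obstruction le -> obstruction (fun a b => le b a).
Proof.
case=> b [t [L [R [LR sL sR]]]]; exists t, b, L, R.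
have flip M : spans le b t M -> spans (fun a b => le b a) t b M.
  case=> linkM bM Mt nM; split=> //.
    by move=> Z Z_cl; apply: linkM => a a' La La'; rewrite orbC; apply: Z_cl.
  by move=> l /nM[].
split; [|exact: flip|exact: flip].
by move=> l r Ll Rr; have [] := LR l r Ll Rr.
Qed.

Section Linked.
Context {A : Type} (le : rel A).

Lemma linked1 (a : A) : linked le (fun x => x = a).
Proof. by move=> Z _ x y -> ->. Qed.

Lemma linked_add (L : A -> Prop) (a0 a : A) : linked le L -> L a0 ->
  le a0 a || le a a0 -> linked le (fun x => L x \/ x = a).
Proof.
move=> linkL La0 cmp Z Z_cl.
have Z_clL x y : L x -> L y -> le x y || le y x -> Z x -> Z y.
  by move=> Lx Ly; apply: Z_cl; left.
have ZL x y : L x -> L y -> Z x -> Z y by apply: linkL.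
have to_a x : L x \/ x = a -> Z x -> Z a.
  case=> [Lx|->//] Zx; apply: (Z_cl a0) => //; [by left|by right|].
  exact: ZL Zx.
have of_a x : L x \/ x = a -> Z a -> Z x.
  case=> [Lx|->//] Za; apply: (ZL a0) => //.
  by apply: (Z_cl a) => //; [by right|by left|rewrite orbC].
by move=> x y Lx Ly Zx; apply: of_a => //; apply: to_a Zx.
Qed.

Lemma linked_seg (w : nat -> A) (lo hi : nat) :
    (forall j, lo <= j < hi -> le (w j) (w j.+1) || le (w j.+1) (w j))%N ->
  linked le (fun x => exists2 j, (lo <= j <= hi)%N & x = w j).
Proof.
move=> w_cmp Z Z_cl.
have iff_lo j : (lo <= j <= hi)%N -> Z (w lo) <-> Z (w j).
  elim: j => [|j IHj]; first by rewrite leqn0 => /andP[/eqP-> _].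
  rewrite leq_eqVlt => /andP[/predU1P[->//|lo_j] j_hi].
  have w_j : exists2 k, (lo <= k <= hi)%N & w j = w k by exists j => //; lia.
  have w_j1 : exists2 k, (lo <= k <= hi)%N & w j.+1 = w k by exists j.+1 => //; lia.
  rewrite IHj; last lia.
  have cmp_j := w_cmp j; split; apply: Z_cl => //; first by apply: cmp_j; lia.
  by rewrite orbC; apply: cmp_j; lia.
by move=> _ _ [j j_in ->] [k k_in ->]; rewrite -!iff_lo.
Qed.

End Linked.

Section Pair.
Context {d : Order.disp_t} {A : finPOrderType d}.
Notation leA := (@Order.le d A).

Lemma spans_pair (b t a1 a2 : A) : a1 <= a2 -> b <= a2 -> a1 <= t ->
  ~~ (a1 <= b) -> ~~ (t <= a2) -> spans leA b t (fun x => x = a1 \/ x = a2).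
Proof.
move=> a12 ba2 a1t a1b ta2; split.
- by apply: linked_add; [exact: linked1|reflexivity|rewrite a12].
- by exists a2 => //; right.
- by exists a1 => //; left.
- move=> l [->|->]; split=> //; last by apply: contraNN a1b; apply: le_trans.
  by apply: contraNN ta2 => ta1; apply: le_trans a12.
Qed.

Lemma apart_pair (a1 a2 : A) (R : A -> Prop) :
    (forall r, R r -> [/\ ~~ (a1 <= r), ~~ (r <= a1), ~~ (a2 <= r) & ~~ (r <= a2)]) ->
  apart leA (fun x => x = a1 \/ x = a2) R.
Proof. by move=> nR l r [->|->] /nR[]. Qed.

End Pair.

Ltac nat_lia := repeat match goal with
  | H : context [@Order.le _ _ _ _] |- _ => clear H
  end; lia.

(** * Shortest paths in [A] around a cover edge of the completion *)

Section Bypass.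
Context {dA dC : Order.disp_t} {A : finPOrderType dA} {C : finPOrderType dC}.
Variable i : A -> C.
Hypothesis i_mono : forall a b, (i a <= i b) = (a <= b).
Hypothesis lower_dense : forall c c',
  ~~ (c <= c') -> exists2 a, i a <= c & ~~ (i a <= c').
Hypothesis upper_dense : forall c c',
  ~~ (c <= c') -> exists2 a, c' <= i a & ~~ (c <= i a).
Hypothesis lower_ex : forall c, exists a, i a <= c.
Hypothesis upper_ex : forall c, exists a, c <= i a.
Hypothesis mid_ex : forall c1 c2 c3 c4 : C,
  c1 <= c3 -> c1 <= c4 -> c2 <= c3 -> c2 <= c4 ->
  exists c, [/\ c1 <= c, c2 <= c, c <= c3 & c <= c4].

Variables u v : C.
Hypothesis uv : covers v u.

(* [a] and [b] are comparable and the order between them does not use the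
   cover relation [u < v]. *)
Definition step (a b : A) : bool :=
  [|| (i a <= i b) && ~~ ((i a <= u) && (v <= i b))
    | (i b <= i a) && ~~ ((i b <= u) && (v <= i a))].

(** Comparability with [u] that avoids the edge in the sense of [step]: automatic below [u], a
    condition above it. Dually for [near_v]. *)
Definition near_u (a : A) : bool := (i a <= u) || (u <= i a) && ~~ (v <= i a).
Definition near_v (a : A) : bool := (v <= i a) || (i a <= v) && ~~ (i a <= u).

(* A [step]-path from [near_u] to [near_v] in [A], completed by [u < v], is a
   cycle in the cover graph of [C]. *)
Fixpoint reach (n : nat) (a : A) : Prop :=
  if n is n'.+1 then exists2 b, reach n' b & step b a else near_u a.

Lemma stepC a b : step a b = step b a. Proof. exact: orbC. Qed.

Lemma step_comparable a b : step a b -> (a <= b) || (b <= a).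
Proof. by rewrite -!i_mono => /orP[] /andP[-> _]; rewrite ?orbT. Qed.

Lemma step_l a b : i a <= i b -> ~~ (i a <= u) -> step a b.
Proof. by rewrite /step => -> /negPf ->. Qed.

Lemma step_r a b : i a <= i b -> ~~ (v <= i b) -> step a b.
Proof. by rewrite /step => -> /negPf ->; rewrite andbF. Qed.

(** On a path of minimal length only the first vertex is [near_u], only the last is [near_v], and
    comparabilities avoiding the edge join consecutive vertices only. The four cases tell on which
    side of [u] and of [v] the two ends lie. In three of them the path gives one arc and two
    elements of [A] around the edge give the other; in the last the path itself is cut. *)
Lemma bypass_obstruction m a : reach m a -> near_v a -> obstruction (@Order.le dA A).
Proof.
move=> reach_a near_a.
have uv_lt := covers_lt uv.
have vu : ~~ (v <= u) by rewrite (lt_geF uv_lt).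
have uv_le := ltW uv_lt.
have [{}m [{}a {reach_a near_a}reach_a near_a] m_min] :
    exists2 m, (exists2 a, reach m a & near_v a) &
      forall n, (exists2 a, reach n a & near_v a) -> (m <= n)%N.
  have exP : exists n, `[< exists2 a, reach n a & near_v a >].
    by exists m; apply/asboolP; exists a.
  case: (ex_minnP exP) => m' /asboolP ex_m' m'_min; exists m' => // n ex_n.
  by apply: m'_min; apply/asboolP.
have [w [w_m w_0 w_step]] : exists w : nat -> A,
    [/\ w m = a, near_u (w 0%N) & forall j, (j < m)%N -> step (w j) (w j.+1)].
  elim: m a reach_a {near_a m_min} => [|m IHm] a /=; first by exists (fun=> a).
  case=> b /IHm[w [w_m w_0 w_step]] ba; exists (fun j => if j == m.+1 then a else w j).
  rewrite eqxx; split=> // j; rewrite ltnS eqSS => j_m.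
  rewrite ifF; last by apply/eqP; nat_lia.
  by case: eqP => [->|nj]; [rewrite w_m|apply: w_step; nat_lia].
rewrite -w_m in near_a => {a reach_a w_m}.
have short n j : (j <= m)%N -> reach n (w j) -> (j <= n)%N.
  move=> j_m reach_j.
  suff reach_m k : (j + k <= m)%N -> reach (n + k) (w (j + k)%N).
    have {reach_m}/m_min : exists2 a, reach (n + (m - j)) a & near_v a.
      by exists (w m) => //; rewrite -{2}(subnKC j_m); apply: reach_m; rewrite subnKC.
    by nat_lia.
  elim: k => [|k IHk] jk_m; first by rewrite !addn0.
  by rewrite !addnS; exists (w (j + k)%N); [apply: IHk; nat_lia|apply: w_step; nat_lia].
have reach_w j : (j <= m)%N -> reach j (w j).
  by elim: j => // j IHj j_m; exists (w j); [apply: IHj; nat_lia|apply: w_step].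
have near_u0 j : (j <= m)%N -> near_u (w j) -> j = 0%N.
  by move=> j_m /(short 0%N j j_m); rewrite leqn0 => /eqP.
have near_u1 s j : (j <= m)%N -> near_u s -> step s (w j) -> (j <= 1)%N.
  by move=> j_m s_u s_j; apply: short => //; exists s.
have chordless j k : (j <= m)%N -> (k <= m)%N -> step (w j) (w k) -> (k <= j.+1)%N.
  by move=> j_m k_m jk; apply: short => //; exists (w j) => //; apply: reach_w.
have near_vm j : (j <= m)%N -> near_v (w j) -> j = m.
  move=> j_m v_j; apply/eqP; rewrite eqn_leq j_m m_min //.
  by exists (w j) => //; apply: reach_w.
have near_v1 s j : (j <= m)%N -> near_v s -> step (w j) s -> (m <= j.+1)%N.
  move=> j_m v_s j_s; apply: m_min; exists s => //; exists (w j) => //; exact: reach_w.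
have m_gt0 : (0 < m)%N.
  rewrite lt0n; apply: contraTneq near_a => m0; rewrite m0 in w_0 *.
  move: w_0; rewrite /near_u /near_v => w_0; apply/negP.
  case/orP: w_0 => [w0u|/andP[u_w0 v_w0]].
    by case/orP => [v_w0|/andP[_ /negP//]]; rewrite (le_trans v_w0 w0u) in vu.
  rewrite (negPf v_w0) /= => /andP[w0_v w0_u].
  case: (covers_between uv u_w0 w0_v) => eq_w0; first by rewrite eq_w0 lexx in w0_u.
  by rewrite eq_w0 lexx in v_w0.
have not_low j : (0 < j <= m)%N -> ~~ (i (w j) <= u).
  case/andP=> j_gt0 j_m; apply/negP => low.
  by move: j_gt0; rewrite (near_u0 j) // /near_u low.
have not_high j : (j < m)%N -> ~~ (v <= i (w j)).
  move=> j_m; apply/negP => high.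
  by move: (near_vm j (ltnW j_m)); rewrite /near_v high => /(_ isT); nat_lia.
have not_above j : (0 < j <= m)%N -> ~~ (v <= i (w j)) -> ~~ (u <= i (w j)).
  case/andP=> j_gt0 j_m nhigh; apply/negP => above.
  by move: j_gt0; rewrite (near_u0 j) // /near_u above nhigh orbT.
have not_below j : (j < m)%N -> ~~ (i (w j) <= u) -> ~~ (i (w j) <= v).
  move=> j_m nlow; apply/negP => below.
  by move: (near_vm j (ltnW j_m)); rewrite /near_v below nlow orbT => /(_ isT); nat_lia.
have cmp_w j : (j < m)%N -> (w j <= w j.+1) || (w j.+1 <= w j).
  by move=> j_m; apply/step_comparable/w_step.
have seg_linked lo hi : (hi <= m)%N ->
    linked (@Order.le dA A) (fun x => exists2 j, (lo <= j <= hi)%N & x = w j).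
  by move=> hi_m; apply: linked_seg => j j_in; apply: cmp_w; nat_lia.
have w1_up : i (w 0%N) <= u -> i (w 0%N) <= i (w 1%N).
  move=> w0u; have := cmp_w 0%N m_gt0; rewrite -!i_mono => /orP[//|w10].
  by have := not_low 1%N m_gt0; rewrite (le_trans w10 w0u).
have w1_above : i (w 0%N) <= u -> ~~ (u <= i (w 1%N)).
  move=> w0u; apply: not_above => //; apply/negP => vw1.
  move: (w_step 0%N m_gt0); rewrite /step w0u vw1 andbF /= => /andP[w10 _].
  by have := le_trans (le_trans vw1 w10) w0u; rewrite (negPf vu).
have wm_down : v <= i (w m) -> i (w m.-1) <= i (w m).
  move=> vwm; have := cmp_w m.-1; rewrite prednK // -!i_mono => /(_ (leqnn _)).
  case/orP=> // wm1; have := not_high m.-1; rewrite prednK // => /(_ (leqnn _)).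
  by rewrite (le_trans vwm wm1).
have wm_below : v <= i (w m) -> ~~ (i (w m.-1) <= v).
  move=> vwm; case: (ltnP 1 m) => [m_gt1|m_le1].
    by apply: not_below; [nat_lia|apply: not_low; nat_lia].
  have m1 : m = 1%N by nat_lia.
  rewrite m1 /= in vwm *; apply/negP => w0v.
  case/orP: w_0 => [w0u|/andP[uw0 _]].
    have := w1_above w0u; rewrite (le_trans _ vwm) //.
  case: (covers_between uv uw0 w0v) => eq_w0.
    by have := w1_above; rewrite eq_w0 lexx (le_trans _ vwm) // => /(_ isT).
  by have := not_high 0%N m_gt0; rewrite eq_w0 lexx.
have [w0u|w0u] := boolP (i (w 0%N) <= u); have [vwm|vwm] := boolP (v <= i (w m)).
- have m_gt1 : (1 < m)%N.
    rewrite ltnNge; apply/negP => m_le1; have m1 : m = 1%N by nat_lia.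
    by rewrite m1 in vwm; have := w1_above w0u; rewrite (le_trans uv_le vwm).
  (* The arc replacing the edge: [a1] under [u] misses [w 1], and [a2] over [v] misses [w m.-1]. Any
     other comparability with the inner path would give a shorter path or an inner vertex near an
     end. *)
  have [a1 a1u a1w] := lower_dense (w1_above w0u).
  have [a2 va2 wa2] := upper_dense (wm_below vwm).
  have a12 : a1 <= a2 by rewrite -i_mono (le_trans a1u) // (le_trans uv_le).
  exists (w 0%N), (w m), (fun x => x = a1 \/ x = a2),
    (fun x => exists2 j, (1 <= j <= m.-1)%N & x = w j); split.
  + apply: apart_pair => _ [j j_in ->]; rewrite -!i_mono; split.
    * apply/negP => a1wj; have := near_u1 a1 j.
      rewrite /near_u a1u step_r //; last by apply: not_high; nat_lia.
      move=> /(_ _ isT isT) j1; have j1' : j = 1%N by nat_lia.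
      by rewrite -j1' a1wj in a1w.
    * by apply/negP => wja1; have := not_low j; rewrite (le_trans wja1 a1u); nat_lia.
    * by apply/negP => a2wj; have := not_high j; rewrite (le_trans va2 a2wj); nat_lia.
    * apply/negP => wja2; have := near_v1 a2 j.
      rewrite /near_v va2 step_l //; last by apply: not_low; nat_lia.
      move=> /(_ _ isT isT) jm; have jm' : j = m.-1 by nat_lia.
      by rewrite -jm' wja2 in wa2.
  + apply: spans_pair; rewrite -?i_mono.
    * by rewrite i_mono.
    * by rewrite (le_trans w0u) // (le_trans uv_le).
    * by rewrite (le_trans a1u) // (le_trans uv_le).
    * by apply: contraNN a1w => a1w0; rewrite (le_trans a1w0) ?w1_up.
    * by apply: contraNN wa2 => wma2; rewrite (le_trans _ wma2) ?wm_down.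
  + split.
    * by apply: seg_linked; nat_lia.
    * by exists (w 1%N); [exists 1%N => //; nat_lia|rewrite -i_mono w1_up].
    * by exists (w m.-1); [exists m.-1 => //; nat_lia|rewrite -i_mono wm_down].
    * move=> _ [j j_in ->]; rewrite -!i_mono; split; apply/negP => wj.
        by have := not_low j; rewrite (le_trans wj w0u); nat_lia.
      by have := not_high j; rewrite (le_trans vwm wj); nat_lia.
- move: near_a; rewrite /near_v (negPf vwm) /= => /andP[wmv wmu].
  have nhigh j : (j <= m)%N -> ~~ (v <= i (w j)).
    by rewrite leq_eqVlt => /predU1P[->|] //; apply: not_high.
  have [a1 a1u a1w] := lower_dense (w1_above w0u).
  have [a2 ua2 wa2] := upper_dense wmu.
  (* The path ends below [v], so no vertex of it can serve as the top; any element of [A] above [v]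
     does. *)
  have [e ve] := upper_ex v.
  have va2 : ~~ (v <= i a2) by apply: contraNN wa2; apply: le_trans.
  exists (w 0%N), e, (fun x => x = a1 \/ x = a2),
    (fun x => exists2 j, (1 <= j <= m)%N & x = w j); split.
  + apply: apart_pair => _ [j j_in ->]; rewrite -!i_mono; split.
    * apply/negP => a1wj; have := near_u1 a1 j.
      rewrite /near_u a1u step_r //; last by apply: nhigh; nat_lia.
      move=> /(_ _ isT isT) j1; have j1' : j = 1%N by nat_lia.
      by rewrite -j1' a1wj in a1w.
    * by apply/negP => wja1; have := not_low j; rewrite (le_trans wja1 a1u); nat_lia.
    * apply/negP => a2wj; have := not_above j; rewrite nhigh; last by nat_lia.
      by rewrite (le_trans ua2 a2wj); nat_lia.
    * apply/negP => wja2.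
      have below_a2 k : (k <= m)%N -> i (w k) <= i a2 -> (k <= 1)%N.
        move=> k_m wka2; apply: (near_u1 a2) => //; first by rewrite /near_u ua2 va2 orbT.
        by rewrite stepC step_r.
      have j1 : j = 1%N by have := below_a2 j; rewrite wja2; nat_lia.
      have m_gt1 : (1 < m)%N.
        by rewrite ltnNge; apply: contraNN wa2 => m_le1; rewrite (_ : m = j) //; nat_lia.
      rewrite j1 in wja2; have := cmp_w 1%N m_gt1; rewrite -!i_mono => /orP[w12|w21].
        have := chordless 0%N 2%N; rewrite m_gt1 step_r ?nhigh // ?(le_trans (w1_up w0u)) //.
        by move=> /(_ isT isT isT).
      by have := below_a2 2%N m_gt1 (le_trans w21 wja2).
  + apply: spans_pair; rewrite -?i_mono.
    * exact: (le_trans a1u).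
    * exact: (le_trans w0u).
    * by rewrite (le_trans a1u) // (le_trans uv_le).
    * by apply: contraNN a1w => a1w0; rewrite (le_trans a1w0) ?w1_up.
    * by apply: contraNN va2 => ea2; rewrite (le_trans ve).
  + split.
    * exact: seg_linked.
    * by exists (w 1%N); [exists 1%N => //; nat_lia|rewrite -i_mono w1_up].
    * by exists (w m); [exists m => //; nat_lia|rewrite -i_mono (le_trans wmv)].
    * move=> _ [j j_in ->]; rewrite -!i_mono; split; apply/negP => wj.
        by have := not_low j; rewrite (le_trans wj w0u); nat_lia.
      by have := nhigh j; rewrite (le_trans ve wj); nat_lia.
(* Order dual of the preceding case, with a bottom [e] under [u]. *)
- move: w_0; rewrite /near_u (negPf w0u) /= => /andP[uw0 vw0].
  have nlow j : (j <= m)%N -> ~~ (i (w j) <= u).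
    by case: j => // j j_m; apply: not_low.
  have [a1 a1v a1w] := lower_dense vw0.
  have [a2 va2 wa2] := upper_dense (wm_below vwm).
  have [e eu] := lower_ex u.
  have a1u : ~~ (i a1 <= u) by apply: contraNN a1w => a1u; rewrite (le_trans a1u).
  exists e, (w m), (fun x => x = a1 \/ x = a2),
    (fun x => exists2 j, (0 <= j <= m.-1)%N & x = w j); split.
  + apply: apart_pair => _ [j j_in ->]; rewrite -!i_mono; split.
    * apply/negP => a1wj.
      have above_a1 k : (k <= m)%N -> i a1 <= i (w k) -> (m <= k.+1)%N.
        move=> k_m a1wk; apply: (near_v1 a1) => //; first by rewrite /near_v a1v a1u orbT.
        by rewrite stepC step_l.
      have jm : j = m.-1 by have := above_a1 j; rewrite a1wj; nat_lia.
      have m_gt1 : (1 < m)%N.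
        by rewrite ltnNge; apply: contraNN a1w => m_le1; rewrite (_ : 0%N = j) //; nat_lia.
      rewrite {}jm {j_in} in a1wj.
      have m2 : m.-2.+1 = m.-1 by nat_lia.
      have := cmp_w m.-2; rewrite m2 -!i_mono => /(_ ltac:(nat_lia)) /orP[w12|w21].
        have := chordless m.-2 m; rewrite step_l ?nlow ?(le_trans w12) ?wm_down //; nat_lia.
      by have := above_a1 m.-2; rewrite (le_trans a1wj w21); nat_lia.
    * by apply/negP => wja1; have := not_below j; rewrite nlow ?(le_trans wja1 a1v); nat_lia.
    * by apply/negP => a2wj; have := not_high j; rewrite (le_trans va2 a2wj); nat_lia.
    * apply/negP => wja2; have := near_v1 a2 j.
      rewrite /near_v va2 step_l //; last by apply: nlow; nat_lia.
      move=> /(_ _ isT isT) jm; have jm' : j = m.-1 by nat_lia.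
      by rewrite -jm' wja2 in wa2.
  + apply: spans_pair; rewrite -?i_mono.
    * exact: (le_trans a1v).
    * by rewrite (le_trans eu) // (le_trans uv_le).
    * exact: le_trans vwm.
    * by apply: contraNN a1u => a1e; rewrite (le_trans a1e).
    * by apply: contraNN wa2 => wma2; rewrite (le_trans _ wma2) ?wm_down.
  + split.
    * by apply: seg_linked; nat_lia.
    * by exists (w 0%N); [exists 0%N|rewrite -i_mono (le_trans eu)].
    * by exists (w m.-1); [exists m.-1 => //; nat_lia|rewrite -i_mono wm_down].
    * move=> _ [j j_in ->]; rewrite -!i_mono; split; apply/negP => wj.
        by have := nlow j; rewrite (le_trans wj eu); nat_lia.
      by have := not_high j; rewrite (le_trans vwm wj); nat_lia.
move: near_a; rewrite /near_v (negPf vwm) /= => /andP[wmv wmu].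
move: w_0; rewrite /near_u (negPf w0u) /= => /andP[uw0 vw0].
have nhigh j : (j <= m)%N -> ~~ (v <= i (w j)).
  by rewrite leq_eqVlt => /predU1P[->|] //; apply: not_high.
have nlow j : (j <= m)%N -> ~~ (i (w j) <= u).
  by case: j => // j j_m; apply: not_low.
have no_chord j k : (j <= m)%N -> (k <= m)%N -> i (w j) <= i (w k) ->
    (j <= k.+1)%N && (k <= j.+1)%N.
  move=> j_m k_m jk; have jk_step : step (w j) (w k) by rewrite step_l ?nlow.
  by rewrite (chordless j k) // (chordless k j) // stepC.
have w10 : i (w 1%N) <= i (w 0%N).
  have := cmp_w 0%N m_gt0; rewrite -!i_mono => /orP[w01|//].
  by have := not_above 1%N m_gt0; rewrite nhigh // (le_trans uw0 w01) => /(_ isT).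
(* Were there a single step, [u] and [w 1] would lie below both [w 0] and [v]. Their midpoint is
   between [u] and [v], hence equal to one of them, against the position of the ends. *)
have m_gt1 : (1 < m)%N.
  rewrite ltnNge; apply/negP => m_le1; have m1 : m = 1%N by nat_lia.
  rewrite m1 in wmv wmu; have [c [uc wc cw cv]] := mid_ex uw0 uv_le w10 wmv.
  case: (covers_between uv uc cv) => eq_c; first by rewrite -eq_c wc in wmu.
  by rewrite -eq_c cw in vw0.
have w1v : ~~ (i (w 1%N) <= v) by apply: not_below => //; apply: nlow.
have w12 : i (w 1%N) <= i (w 2%N).
  have := cmp_w 1%N m_gt1; rewrite -!i_mono => /orP[//|w21].
  by have /andP[] := no_chord 2%N 0%N m_gt1 isT (le_trans w21 w10).
have m_gt2 : (2 < m)%N.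
  rewrite ltnNge; apply/negP => m_le2; have m2 : m = 2%N by nat_lia.
  by rewrite m2 in wmv; rewrite (le_trans w12 wmv) in w1v.
have w32 : i (w 3%N) <= i (w 2%N).
  have := cmp_w 2%N m_gt2; rewrite -!i_mono => /orP[w23|//].
  by have /andP[] := no_chord 1%N 3%N m_gt0 m_gt2 (le_trans w12 w23).
(* The path goes down, up, down: [w 2] is the top, [w 1] and [w 0] form one arc, and [e] links the
   far end of the path to a bottom under [u]. *)
have [e ve w1e] := upper_dense w1v.
have [b bu] := lower_ex u.
have w0e : ~~ (i (w 0%N) <= i e) by apply: contraNN w1e; apply: le_trans.
exists b, (w 2%N), (fun x => x = w 1%N \/ x = w 0%N),
  (fun x => (exists2 j, (3 <= j <= m)%N & x = w j) \/ x = e); split.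
- apply: apart_pair => r; rewrite -!i_mono => -[[j j_in ->]|->].
    split; apply/negP => le_w.
    + have := no_chord 1%N j; rewrite le_w; nat_lia.
    + have := no_chord j 1%N; rewrite le_w; nat_lia.
    + have := no_chord 0%N j; rewrite le_w; nat_lia.
    + have := no_chord j 0%N; rewrite le_w; nat_lia.
  split=> //; apply/negP => le_e.
    by have := nhigh 1%N; rewrite (le_trans ve le_e) => /(_ m_gt0).
  by rewrite (le_trans ve le_e) in vw0.
- apply: spans_pair; rewrite -?i_mono //.
  + exact: le_trans bu uw0.
  + by apply: contraNN (nlow 1%N m_gt0) => w1b; apply: le_trans bu.
  + by apply/negP => /(no_chord 2%N 0%N m_gt1 isT)/andP[].
split.
- apply: (linked_add (a0 := w m)); [exact: seg_linked|by exists m => //; nat_lia|].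
  by rewrite -i_mono (le_trans wmv).
- by exists e; [right|rewrite -i_mono (le_trans bu) // (le_trans uv_le)].
- by exists (w 3%N); [left; exists 3%N => //; nat_lia|rewrite -i_mono].
- move=> r; rewrite -!i_mono => -[[j j_in ->]|->]; split; apply/negP => le_r.
  + by have := nlow j; rewrite (le_trans le_r bu); nat_lia.
  + have j3 : j = 3%N by have := no_chord 2%N j; rewrite le_r; nat_lia.
    by have := no_chord 1%N j; rewrite (le_trans w12 le_r); nat_lia.
  + by rewrite (le_trans ve (le_trans le_r bu)) in vu.
  + by move/negP: w1e; rewrite (le_trans w12 le_r).
Qed.

End Bypass.

Section Acyclic.
Context {dA dC : Order.disp_t} {A : finPOrderType dA} {C : finPOrderType dC}.
Variable i : A -> C.
Hypothesis i_mono : forall a b, (i a <= i b) = (a <= b).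
Hypothesis lower_dense : forall c c',
  ~~ (c <= c') -> exists2 a, i a <= c & ~~ (i a <= c').
Hypothesis upper_dense : forall c c',
  ~~ (c <= c') -> exists2 a, c' <= i a & ~~ (c <= i a).
Hypothesis lower_ex : forall c, exists a, i a <= c.
Hypothesis upper_ex : forall c, exists a, c <= i a.
Hypothesis mid_ex : forall c1 c2 c3 c4 : C,
  c1 <= c3 -> c1 <= c4 -> c2 <= c3 -> c2 <= c4 ->
  exists c, [/\ c1 <= c, c2 <= c, c <= c3 & c <= c4].

(** The same comparability for an arbitrary point [c] of the completion. When [~~ (v <= u)], the
    instances at [u] and [v] are [near_u] and [near_v]. *)
Definition attached (u v c : C) (a : A) : bool :=
  [|| (i a <= c) && ~~ ((i a <= u) && (v <= c))
    | (c <= i a) && ~~ ((c <= u) && (v <= i a))].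

(** As [c] need not come from [A], it is replaced by a hub [lo <= c <= hi]. Density lets [lo] be
    below [u] only if [c] is, and [hi] above [v] only if [c] is, so detours through the hub never
    use the forbidden relation. *)
Lemma attached_reach (u v c : C) (a b : A) : ~~ (v <= u) ->
  attached u v c a -> attached u v c b ->
  (exists n, reach i u v n a) -> exists n, reach i u v n b.
Proof.
move=> vu ca cb [n reach_a].
have [lo lo_c lo_u] : exists2 a, i a <= c & (i a <= u) -> (c <= u).
  case: (boolP (c <= u)) => [cu|/lower_dense[a' ac au]]; last by exists a' => // /(negP au).
  by have [a' a'c] := lower_ex c; exists a'.
have [hi c_hi hi_v] : exists2 a, c <= i a & (v <= i a) -> (v <= c).
  case: (boolP (v <= c)) => [vc|/upper_dense[a' ca' va']]; last by exists a' => // /(negP va').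
  by have [a' a'c] := upper_ex c; exists a'.
have lo_hi : step i u v lo hi.
  rewrite /step (le_trans lo_c c_hi) /=; apply/orP; left.
  by apply: contraNN vu => /andP[/lo_u cu /hi_v vc]; apply: le_trans cu.
have near_hub x : attached u v c x -> step i u v lo x \/ step i u v x hi.
  rewrite /step; case/orP=> /andP[cx ncx]; [right|left].
    rewrite (le_trans cx c_hi) /=; apply/orP; left.
    by apply: contraNN ncx => /andP[-> /hi_v].
  rewrite (le_trans lo_c cx) /=; apply/orP; left.
  by apply: contraNN ncx => /andP[/lo_u -> ->].
have [k reach_lo] : exists k, reach i u v k lo.
  case: (near_hub a ca) => [lo_a|a_hi].
    by exists n.+1; exists a; rewrite // stepC.
  by exists n.+2; exists hi; [exists a|rewrite stepC].
case: (near_hub b cb) => [lo_b|b_hi]; first by exists k.+1; exists lo.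
by exists k.+2; exists hi; [exists lo|rewrite stepC].
Qed.

Lemma completion_acyclic : ~ obstruction (@Order.le dA A) -> acyclic_poset C.
Proof.
move=> nobs /cycle_bypass[u [v [uv]]]; apply/negP.
have vu : ~~ (v <= u) by rewrite (lt_geF (covers_lt uv)).
set e := (X in connect X); apply/negP => /connectP[p e_p last_p].
pose left c := exists2 a, attached u v c a & exists n, reach i u v n a.
suff /(_ u p e_p) left_last : forall c q, path e c q -> left c -> left (last c q).
  have [] : left v.
    rewrite last_p; apply: left_last; have [a au] := lower_ex u.
    exists a; first by rewrite /attached au (negPf vu) andbF.
    by exists 0%N; rewrite /= /near_u au.
  move=> a va reach_a; apply: nobs; have [b vb] := upper_ex v.
  have [|n reach_b] := @attached_reach u v v a b vu va _ reach_a.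
    by rewrite /attached vb (negPf vu) /= orbT.
  apply: (bypass_obstruction i_mono lower_dense upper_dense lower_ex upper_ex mid_ex uv reach_b).
  by rewrite /near_v vb.
move=> c q; elim: q c => //= x q IHq c /andP[e_cx e_q] [a ca reach_a]; apply: IHq => //.
(* Neighbours share an attached element: if the lower one is not below [u], an element under it that
   is not below [u]. Otherwise the upper one is not above [v], or the edge would be the deleted one,
   and an element over it that is not above [v] serves. *)
have [b cb xb] : exists2 b, attached u v c b & attached u v x b; last first.
  by exists b => //; exact: (@attached_reach u v c a b vu ca cb reach_a).
wlog : c x e_cx {ca e_q} / covers x c.
  move=> IH; case/andP: (e_cx) => /orP[] cov _; last exact: IH.
  have [|b xb cb] := IH x c _ cov; last by exists b.
  move: e_cx; rewrite /e /= cover_adj_sym orbC.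
  by rewrite [(c == v) && _]andbC [(c == u) && _]andbC.
move=> cov; have cx := ltW (covers_lt cov).
case: (boolP (c <= u)) => cu.
  have /upper_dense[b xb vb] : ~~ (v <= x).
    apply/negP => vx; move: e_cx; rewrite /e /=.
    case: (covers_between cov cu (le_trans (ltW (covers_lt uv)) vx)) => eq_u.
      case: (covers_between cov (le_trans cu (ltW (covers_lt uv))) vx) => eq_v.
        by rewrite -eq_v in eq_u; move: (covers_lt uv); rewrite eq_u ltxx.
      by rewrite eq_u eq_v !eqxx andbF.
    by move: vu; rewrite eq_u vx.
  by exists b; rewrite /attached ?xb ?(le_trans cx xb) (negPf vb) !andbF orbT.
have [b bc bu] := lower_dense cu.
by exists b; rewrite /attached ?bc ?(le_trans bc cx) (negPf bu).
Qed.

End Acyclic.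

(** * The completion by cuts *)

Section Cuts.
Context {d : Order.disp_t} (A : finPOrderType d).

Definition upper_bounds (L : {set A}) : {set A} := [set b | [forall a in L, a <= b]].
Definition lower_bounds (U : {set A}) : {set A} := [set a | [forall b in U, a <= b]].

(* The Dedekind-MacNeille completion without its artificial bottom and top. *)
Definition is_cut (L : {set A}) : bool :=
  [&& lower_bounds (upper_bounds L) == L, L != finset.set0 & upper_bounds L != finset.set0].

Definition cut := {L : {set A} | is_cut L}.
HB.instance Definition _ := SubFinite.on cut.

Definition cut_le : rel cut := [rel L M : cut | val L \subset val M].

Lemma cut_le_refl : reflexive cut_le.
Proof. by move=> L; apply: subxx. Qed.

Lemma cut_le_anti : antisymmetric cut_le.
Proof. by move=> L M LM; apply/val_inj/eqP; rewrite finset.eqEsubset. Qed.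

Lemma cut_le_trans : transitive cut_le.
Proof. by move=> M L N; apply: fintype.subset_trans. Qed.

HB.instance Definition _ := Order.Le_isPOrder.Build Order.default_display cut
  cut_le_refl cut_le_anti cut_le_trans.

Lemma upper_boundsP (L : {set A}) b :
  reflect (forall a, a \in L -> a <= b) (b \in upper_bounds L).
Proof. by rewrite inE; apply: forall_inP. Qed.

Lemma lower_boundsP (U : {set A}) a :
  reflect (forall b, b \in U -> a <= b) (a \in lower_bounds U).
Proof. by rewrite inE; apply: forall_inP. Qed.

Lemma cut_closed (L : cut) a :
  (forall b, b \in upper_bounds (val L) -> a <= b) -> a \in val L.
Proof. by case: L => L /= /andP[/eqP eqL _] a_lo; rewrite -eqL; apply/lower_boundsP. Qed.

Lemma principal_is_cut (a : A) : is_cut [set b | b <= a].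
Proof.
apply/and3P; split.
- rewrite finset.eqEsubset; apply/andP; split; apply/fintype.subsetP=> b.
    move/lower_boundsP=> b_lo; rewrite inE; apply: b_lo.
    by apply/upper_boundsP=> c; rewrite inE.
  by move=> ba; apply/lower_boundsP=> c /upper_boundsP; apply.
- by apply/finset.set0Pn; exists a; rewrite inE.
- by apply/finset.set0Pn; exists a; apply/upper_boundsP=> c; rewrite inE.
Qed.

Definition principal (a : A) : cut := Sub _ (principal_is_cut a).

Lemma principal_le (a : A) (L : cut) : (principal a <= L) = (a \in val L).
Proof.
apply/fintype.subsetP/idP => [|aL b]; first by apply; rewrite inE.
by rewrite inE => ba; apply: cut_closed => c /upper_boundsP/(_ a aL); apply: le_trans.
Qed.

Lemma le_principal (L : cut) (a : A) : (L <= principal a) = (a \in upper_bounds (val L)).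
Proof.
apply/fintype.subsetP/upper_boundsP => La b /La; by rewrite inE.
Qed.

Lemma principal_mono a b : (principal a <= principal b) = (a <= b).
Proof. by rewrite principal_le inE. Qed.

Lemma principal_lower_dense (L M : cut) :
  ~~ (L <= M) -> exists2 a, principal a <= L & ~~ (principal a <= M).
Proof. by case/fintype.subsetPn=> a aL aM; exists a; rewrite principal_le. Qed.

Lemma principal_upper_dense (L M : cut) :
  ~~ (L <= M) -> exists2 a, M <= principal a & ~~ (L <= principal a).
Proof.
case/fintype.subsetPn=> a aL aM; apply: contrapT => noex.
move/negP: aM; apply; apply: cut_closed => b bM; apply: contrapT => nab.
apply: noex; exists b; rewrite le_principal //.
by apply/upper_boundsP => /(_ a aL).
Qed.

(** The intersection of [M1] and [M2] works: [L1] keeps it nonempty although the bottom cut was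
    discarded, and every upper bound of [M1] bounds it. This is how bowties of [A] acquire
    midpoints. *)
Lemma cut_meet (L1 L2 M1 M2 : cut) :
  L1 <= M1 -> L1 <= M2 -> L2 <= M1 -> L2 <= M2 ->
  exists N, [/\ L1 <= N, L2 <= N, N <= M1 & N <= M2].
Proof.
move=> L1M1 L1M2 L2M1 L2M2.
have meet_cut : is_cut (val M1 :&: val M2).
  have upS (M : cut) : val M1 :&: val M2 \subset val M -> 
      {subset upper_bounds (val M) <= upper_bounds (val M1 :&: val M2)}.
    move=> /fintype.subsetP sub b /upper_boundsP bM; apply/upper_boundsP=> a /sub.
    exact: bM.
  apply/and3P; split.
  - rewrite finset.eqEsubset; apply/andP; split; apply/fintype.subsetP=> a.
      move=> /lower_boundsP a_lo; rewrite inE; apply/andP; split;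
        by apply: cut_closed => b /upS; rewrite ?finset.subsetIl ?finset.subsetIr => /(_ isT)/a_lo.
    by move=> aM; apply/lower_boundsP=> b /upper_boundsP; apply.
  - have /finset.set0Pn[a aL1] : val L1 != finset.set0 by case: (L1) => ? /= /and3P[].
    by apply/finset.set0Pn; exists a; rewrite inE (fintype.subsetP L1M1) ?(fintype.subsetP L1M2).
  - have /finset.set0Pn[a /upS] : upper_bounds (val M1) != finset.set0 by case: (M1) => ? /= /and3P[].
    by rewrite finset.subsetIl => /(_ isT) a_up; apply/finset.set0Pn; exists a.
pose N : cut := Sub _ meet_cut.
have le_N (L : cut) : L <= M1 -> L <= M2 -> L <= N.
  by move=> LM1 LM2; apply/fintype.subsetP=> a aL;
     rewrite inE (fintype.subsetP LM1) ?(fintype.subsetP LM2).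
exists N; split; [exact: le_N|exact: le_N|exact: finset.subsetIl|exact: finset.subsetIr].
Qed.

Lemma acyclic_extension : ~ obstruction (@Order.le d A) ->
  exists (dB : Order.disp_t) (B : finPOrderType dB), acyclic_poset B /\ has_induced B A.
Proof.
move=> nobs; exists Order.default_display, (cut : finPOrderType _); split.
  apply: (completion_acyclic principal_mono principal_lower_dense principal_upper_dense
           _ _ cut_meet nobs) => L.
    have /finset.set0Pn[a aL] : val L != finset.set0 by case: (L) => ? /= /and3P[].
    by exists a; rewrite principal_le.
  have /finset.set0Pn[a aL] : upper_bounds (val L) != finset.set0 by case: (L) => ? /= /and3P[].
  by exists a; rewrite le_principal.
exact: embedding_has_induced principal_mono.
Qed.

End Cuts.

Local Close Scope order_scope.

Import GRing.Theory Num.Theory.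

Local Open Scope ring_scope.

(** * Probability measures on finite sets *)

Section Pmf.
Context {R : realType} {T : finType}.

Definition is_pmf (p : T -> R) : Prop := (forall t, 0 <= p t) /\ \sum_t p t = 1.

Section Measure.
Variables (x0 : T) (p : T -> R).
Hypothesis p_pmf : is_pmf p.

(** A sum of scaled Dirac measures, indexed by positions in the enumeration because [msum] runs over
    naturals; the measure structure is then inherited. *)
Definition pmf_measure : set (discrete x0) -> \bar R :=
  msum (fun k => mscale (NngNum (p_pmf.1 (nth x0 (enum T) k)))
                        (dirac (nth x0 (enum T) k : discrete x0))) #|T|.

HB.instance Definition _ := Measure.on pmf_measure.

Lemma pmf_measureE (U : set T) : pmf_measure U = (\sum_(t | t \in U) p t)%:E.
Proof.
pose f t := p t * (t \in U)%:R.
transitivity (\sum_(k < #|T|) f (nth x0 (enum T) k))%:E.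
  rewrite -sumEFin /pmf_measure /msum /=; apply: eq_bigr => k _.
  by rewrite /mscale /= diracE -EFinM.
congr (_%:E); transitivity (\sum_(0 <= k < #|T|) f (nth x0 (enum T) k)).
  by rewrite big_mkord.
rewrite cardE -(big_nth x0 xpredT f) big_enum /= [RHS]big_mkcond.
by apply: eq_bigr => t _; rewrite /f; case: ifP; rewrite ?mulr1 ?mulr0.
Qed.

Lemma pmf_measure_setT : pmf_measure [set: T] = 1%E.
Proof. by rewrite pmf_measureE (eq_bigl xpredT) ?p_pmf.2 // => t; rewrite in_setT. Qed.

HB.instance Definition _ :=
  Measure_isProbability.Build _ _ _ pmf_measure pmf_measure_setT.

End Measure.

Lemma pmf_probability (x0 : T) (p : T -> R) : is_pmf p ->
  exists P : probability (discrete x0) R,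
    forall U : set T, P U = (\sum_(t | t \in U) p t)%:E.
Proof. by move=> p_pmf; exists (pmf_measure (x0:=x0) p_pmf) => U; apply: pmf_measureE. Qed.

Definition pmf_of {x0 : T} (P : probability (discrete x0) R) (t : T) : R := fine (P [set t]%classic).

Lemma pmf_ofE {x0 : T} (P : probability (discrete x0) R) (U : set T) :
  P U = (\sum_(t | t \in U) pmf_of P t)%:E.
Proof.
have -> : P U = P (\bigcup_(t in U) [set t])%classic by rewrite bigcup_imset1 image_id.
rewrite measure_fin_bigcup //; last by move=> i j _ _ [x [-> ->]].
  transitivity (\sum_(t <- enum T | t \in U) P [set t]%classic)%E.
    by rewrite [RHS]bigfs ?set_mem_set ?enum_uniq // => t _; rewrite mem_enum.
  rewrite big_enum_cond /= -sumEFin; apply: eq_bigr => t _.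
  by rewrite /pmf_of fineK // fin_num_measure.
exact: finite_finset.
Qed.

Lemma pmf_of_pmf {x0 : T} (P : probability (discrete x0) R) : is_pmf (pmf_of P).
Proof.
split=> [t|]; first exact/fine_ge0/measure_ge0.
apply: EFin_inj; rewrite -(@probability_setT _ _ _ P) pmf_ofE.
by congr (_%:E); apply: eq_bigl => t; rewrite in_setT.
Qed.

End Pmf.

(** * Monotone realizations on finite probability spaces *)

Section Coupling.
Context {R : realType} {A S : finType} (leA : rel A) (leS : rel S).

(** The order is required only at outcomes of nonzero weight, since gluing produces null outcomes
    that violate it. Plain relations allow both orders to be reversed. *)
Definition monotone_coupling (p : A -> S -> R) : Prop :=
  exists (Omega : finType) (q : Omega -> R) (X : A -> Omega -> S),
    [/\ is_pmf q,
        forall a s, \sum_(w | X a w == s) q w = p a s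
      & forall a b w, leA a b -> q w != 0 -> leS (X a w) (X b w)].

End Coupling.

Section DiscreteFunction.
Context {T U : choiceType} (x0 : T) (y0 : U) (f : T -> U).

Definition discrete_function : discrete x0 -> discrete y0 := f.

Lemma measurable_discrete_function : measurable_fun setT discrete_function.
Proof. by []. Qed.

HB.instance Definition _ :=
  isMeasurableFun.Build _ _ _ _ discrete_function measurable_discrete_function.

End DiscreteFunction.

Section Realizable.
Context {R : realType} {dA dS : Order.disp_t} {A : finPOrderType dA} {S : finPOrderType dS}.
Context {x0 : S} (P : A -> probability (discrete x0) R).

Lemma realizably_monotone_of_coupling :
  monotone_coupling <=%O <=%O (fun a => pmf_of (P a)) -> realizably_monotone P.
Proof.
case=> Omega [q [X [q_pmf X_law X_mono]]].
have [w0 _] : exists w : Omega, true.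
  apply: contrapT => noW; have := q_pmf.2; rewrite big1 => [/esym/eqP|w _].
    by rewrite oner_eq0.
  by case: noW; exists w.
have [Q QE] := pmf_probability w0 q_pmf.
(* A constant value at null outcomes makes the order hold at every outcome. *)
pose Y a (w : Omega) := if q w == 0 then x0 else X a w.
exists default_measure_display, (discrete w0), Q,
  (fun a => @discrete_function Omega S w0 x0 (Y a) : {RV Q >-> discrete x0}).
split=> [a b ab w|a U].
  rewrite /= /discrete_function /Y; case: eqVneq => // qw; exact: X_mono.
rewrite (pmf_ofE (P a)); transitivity (Q (Y a @^-1` U)%classic); first by [].
rewrite QE; congr (_%:E).
under [RHS]eq_bigr do rewrite -X_law.
rewrite (exchange_big_dep xpredT) //= big_mkcond; apply: eq_bigr => w _.
have [qw|qw] := eqVneq (q w) 0; first by rewrite qw if_same big1_eq.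
have -> : (w \in (Y a @^-1` U)%classic) = (X a w \in U).
  by apply/idP/idP => /set_mem /= UY; apply/mem_set; move: UY; rewrite /Y /= (negPf qw).
case: ifP => Xw; last first.
  by rewrite big_pred0 // => s; apply/negP => /andP[sU /eqP eq_s]; rewrite eq_s sU in Xw.
rewrite (big_pred1 (X a w)) // => s /=; rewrite [X a w == s]eq_sym.
by case: eqVneq => [->|_]; rewrite ?Xw ?andbF.
Qed.

(** Only the joint law matters, and it lives on the finite set of maps from [A] to [S]. A map of
    nonzero weight is attained at some outcome, hence is monotone. *)
Lemma coupling_of_realizably_monotone :
  realizably_monotone P -> monotone_coupling <=%O <=%O (fun a => pmf_of (P a)).
Proof.
move=> [dO [T [Pr [X [X_mono X_law]]]]].
pose Phi (w : T) : {ffun A -> S} := [ffun a => X a w].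
pose phi0 : {ffun A -> S} := [ffun=> x0].
have Phi_mfun : measurable_fun setT (Phi : T -> discrete phi0).
  move=> _ U _; rewrite setTI.
  have -> : (Phi @^-1` U = \bigcup_(phi in U) \bigcap_(a in [set: A]) X a @^-1` [set phi a])%classic.
    apply/seteqP; split=> [w /= UPhi|w [phi Uphi eqX] /=].
      by exists (Phi w) => // a _ /=; rewrite ffunE.
    suff -> : Phi w = phi by [].
    by apply/ffunP => a; rewrite ffunE; apply: eqX.
  apply: fin_bigcup_measurable => [|phi _]; first exact: finite_finset.
  apply: fin_bigcap_measurable => [|a _]; first exact: finite_finset.
  by rewrite -[X in measurable X]setTI; apply: measurable_funP.
pose Phi_RV : {mfun T >-> discrete phi0} := HB.pack (Phi : T -> discrete phi0)
  (isMeasurableFun.Build _ _ _ _ (Phi : T -> discrete phi0) Phi_mfun).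
pose Q : probability (discrete phi0) R := distribution Pr Phi_RV.
have QE U : Q U = Pr (Phi @^-1` U)%classic by [].
exists ({ffun A -> S} : finType), (pmf_of Q), (fun a (phi : {ffun A -> S}) => phi a); split.
- exact: pmf_of_pmf.
- move=> a s; apply: EFin_inj.
  transitivity (Q [set phi : {ffun A -> S} | phi a = s]%classic).
    by rewrite pmf_ofE; congr (_%:E); apply: eq_bigl => phi; apply/eqP/idP; rewrite inE.
  rewrite QE /pmf_of fineK ?fin_num_measure // -X_law.
  congr (Pr _); apply/seteqP; split=> w /=; rewrite ffunE //.
- move=> a b phi ab; rewrite /pmf_of => Qphi.
  have [[w phi_w]|noW] := pselect (exists w, Phi w = phi).
    by rewrite -phi_w !ffunE; apply: X_mono.
  move: Qphi; rewrite QE (_ : (_ @^-1` _)%classic = set0) ?measure0 ?eqxx //.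
  by apply/seteqP; split=> // w /= eq_phi; apply: noW; exists w.
Qed.

Lemma stochastically_monotoneP : stochastically_monotone P <->
  forall a b (U : {pred S}), (a <= b)%O ->
    (forall x y, x \in U -> (x <= y)%O -> y \in U) ->
    \sum_(s in U) pmf_of (P a) s <= \sum_(s in U) pmf_of (P b) s.
Proof.
split=> [P_mono a b U ab U_up|P_mono a b ab U U_up].
  have := P_mono a b ab [set` U]%classic; rewrite !pmf_ofE lee_fin.
  have sumU (p : S -> R) : \sum_(s | s \in [set` U]%classic) p s = \sum_(s in U) p s.
    by apply: eq_bigl => s; apply/idP/idP => [/set_mem|/mem_set].
  by rewrite !sumU; apply=> x y Ux xy; apply: U_up Ux xy.
rewrite (pmf_ofE (P a)) (pmf_ofE (P b)) lee_fin; apply: (P_mono a b (fun s => s \in U)) => // x y.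
by move=> /set_mem Ux xy; apply/mem_set; apply: U_up xy.
Qed.

End Realizable.

(** * A system without monotone realization *)

Section Events.
Context {R : realType} {Omega : finType} (q : Omega -> R).
Hypothesis q_ge0 : forall w, 0 <= q w.

Lemma null_event (E : pred Omega) : \sum_(w | E w) q w = 0 ->
  forall w, q w != 0 -> ~~ E w.
Proof.
move=> E0 w; apply: contraNN => Ew; apply/eqP; move: w Ew.
by apply: psumr_eq0P E0 => w _.
Qed.

Lemma event_eq (E F : pred Omega) :
    (forall w, q w != 0 -> E w -> F w) -> \sum_(w | E w) q w = \sum_(w | F w) q w ->
  forall w, q w != 0 -> E w = F w.
Proof.
move=> EF eq_sum w qw; apply/idP/idP; first exact: EF.
apply: contraTT => nEw; have := @null_event (fun w => F w && ~~ E w) _ w qw.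
rewrite nEw andbT; apply.
move: eq_sum; rewrite [RHS](bigID E) /=.
have -> : \sum_(w | F w && E w) q w = \sum_(w | E w) q w; last by lra.
rewrite big_mkcond [RHS]big_mkcond; apply: eq_bigr => v _.
have [-> |qv] := eqVneq (q v) 0; first by rewrite !if_same.
by have := EF v qv; case: (E v); rewrite ?andbF ?andbT // => ->.
Qed.

End Events.

Section Counterexample.
Context {R : realType} {A S : finType} (leA : rel A) (leS : rel S).
Hypothesis leA_refl : reflexive leA.
Hypothesis leA_trans : transitive leA.
Hypothesis leS_refl : reflexive leS.
Context {x y z w : S}.
Hypotheses (xz : leS x z) (yz : leS y z) (zw : leS z w).
Hypotheses (yx : ~~ leS y x) (zx : ~~ leS z x) (wx : ~~ leS w x).
Hypotheses (xy : ~~ leS x y) (zy : ~~ leS z y) (wy : ~~ leS w y).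
Hypothesis wz : ~~ leS w z.
Context {b t : A} {L M : A -> Prop}.
Hypotheses (LM : apart leA L M) (bLt : spans leA b t L) (bMt : spans leA b t M).

(** Down-closures of the two arcs, and up-closure of their union. As the arcs are nowhere
    comparable, no element lies in all three, which keeps the mass left at [z] nonnegative below. *)
Let F (a : A) : bool := `[< exists2 l, L l & leA a l >].
Let G (a : A) : bool := `[< exists2 l, M l & leA a l >].
Let H (a : A) : bool := `[< exists2 l, L l \/ M l & leA l a >].

(* The law of a point of [F /\ G] is uniform on [{x, y}], of [F /\ H] on
   [{x, w}], of [G /\ H] on [{y, w}] and of [H] alone on [{z, w}]. A monotone
   realization must keep the coin toss constant along comparabilities, but going
   around the cycle b - L - t - M - b flips it. *)
Definition crossed (a : A) (s : S) : R :=
  (F a)%:R / 2 * (s == x)%:R + (G a)%:R / 2 * (s == y)%:R + (H a)%:R / 2 * (s == w)%:R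
  + (1 - (F a)%:R / 2 - (G a)%:R / 2 - (H a)%:R / 2) * (s == z)%:R.

Let FGH a : ~~ [&& F a, G a & H a].
Proof.
apply/negP => /and3P[/asboolP[l Ll al] /asboolP[m Mm am] /asboolP[n [Ln|Mn] na]].
  by have [/negP + _] := LM Ln Mm; apply; apply: leA_trans am.
by have [_ /negP +] := LM Ll Mn; apply; apply: leA_trans al.
Qed.

Let F_anti a c : leA a c -> F c -> F a.
Proof. by move=> ac /asboolP[l Ll cl]; apply/asboolP; exists l => //; apply: leA_trans cl. Qed.

Let G_anti a c : leA a c -> G c -> G a.
Proof. by move=> ac /asboolP[l Ll cl]; apply/asboolP; exists l => //; apply: leA_trans cl. Qed.

Let H_mono a c : leA a c -> H a -> H c.
Proof. by move=> ac /asboolP[l Ll la]; apply/asboolP; exists l => //; apply: leA_trans ac. Qed.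

Let sum_indicator (U : pred S) (s0 : S) : \sum_(s | U s) (s == s0)%:R = (U s0)%:R :> R.
Proof.
rewrite big_mkcond (bigD1 s0) //= eqxx big1 ?addr0 => [|s /negPf ->]; last by rewrite if_same.
by case: (U s0).
Qed.

Lemma crossed_sum (U : pred S) a : \sum_(s | U s) crossed a s =
  (F a)%:R / 2 * (U x)%:R + (G a)%:R / 2 * (U y)%:R + (H a)%:R / 2 * (U w)%:R
  + (1 - (F a)%:R / 2 - (G a)%:R / 2 - (H a)%:R / 2) * (U z)%:R.
Proof. by rewrite !big_split /= -!mulr_sumr !sum_indicator. Qed.

Lemma crossed_pmf a : is_pmf (crossed a).
Proof.
split=> [s|]; last by rewrite (crossed_sum xpredT) /=; lra.
have nat_ge0 (c : bool) : 0 <= c%:R :> R by rewrite ler0n.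
rewrite /crossed !addr_ge0 ?mulr_ge0 ?divr_ge0 ?nat_ge0 ?ler0n //.
by move: (FGH a); case: (F a); case: (G a); case: (H a) => //= _; lra.
Qed.

(** Going up in [A] one can only leave [F] and [G] and enter [H], so halves of the mass move from
    [x] to [z], from [y] to [z] and from [z] to [w], all upward. The three products of [mul_ge0] are
    these moves as seen by [U]. *)
Lemma crossed_mono (U : pred S) a c : leA a c -> (forall s s', U s -> leS s s' -> U s') ->
  \sum_(s | U s) crossed a s <= \sum_(s | U s) crossed c s.
Proof.
move=> ac U_up; rewrite !crossed_sum -subr_ge0.
have mul_ge0 (f f' u u' : bool) : (f' -> f) -> (u -> u') ->
    0 <= (f%:R - f'%:R) * (u'%:R - u%:R) :> R.
  move=> ff uu; rewrite mulr_ge0 // subr_ge0 ler_nat.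
    by case: f' ff => // ->.
  by case: u uu => // ->.
have := mul_ge0 _ _ _ _ (F_anti ac) (fun Ux => U_up _ _ Ux xz).
have := mul_ge0 _ _ _ _ (G_anti ac) (fun Uy => U_up _ _ Uy yz).
have := mul_ge0 _ _ _ _ (H_mono ac) (fun Uz => U_up _ _ Uz zw).
lra.
Qed.

Let neq_le s s' : ~~ leS s s' -> (s == s') = false.
Proof. by apply: contraNF => /eqP ->. Qed.

Lemma crossed_no_coupling : ~ monotone_coupling leA leS crossed.
Proof.
case=> T [q [X [[q_ge0 q1] X_law X_mono]]].
have [e qe] : exists e, q e != 0.
  apply: contrapT => noe; move: q1; rewrite big1 => [/esym/eqP|e _].
    by rewrite oner_eq0.
  by apply/eqP; apply: contrapT => /negP qe; apply: noe; exists e.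
have distinct := (neq_le yx, neq_le zx, neq_le wx, neq_le xy, neq_le zy, neq_le wy, neq_le wz,
  etrans (eq_sym _ _) (neq_le zx), etrans (eq_sym _ _) (neq_le wx),
  etrans (eq_sym _ _) (neq_le zy), etrans (eq_sym _ _) (neq_le wy), etrans (eq_sym _ _) (neq_le wz)).
have crossed_x a : crossed a x = (F a)%:R / 2.
  by rewrite /crossed eqxx !distinct /= mulr1 !mulr0 ?addr0 ?add0r.
have crossed_y a : crossed a y = (G a)%:R / 2.
  by rewrite /crossed eqxx !distinct /= mulr1 !mulr0 ?addr0 ?add0r.
have crossed_w a : crossed a w = (H a)%:R / 2.
  by rewrite /crossed eqxx !distinct /= mulr1 !mulr0 ?addr0 ?add0r.
have X_neq a s v : q v != 0 -> crossed a s = 0 -> X a v != s.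
  by move=> qv p0; apply: (null_event q_ge0 (E := fun v => X a v == s)) qv; rewrite X_law.
have X_supp a v : q v != 0 -> [\/ X a v = x, X a v = y, X a v = z | X a v = w].
  move=> qv; have := X_neq a (X a v) v qv; rewrite eqxx /crossed.
  case: eqVneq => [|_]; first by constructor.
  case: eqVneq => [|_]; first by constructor.
  case: eqVneq => [|_]; first by constructor.
  case: eqVneq => [|_]; first by constructor.
  by rewrite !mulr0 !addr0 => /(_ erefl).
have le_x a v : q v != 0 -> leS (X a v) x -> X a v = x.
  by move=> qv; case: (X_supp a v qv) => -> // le; move: le yx zx wx => -> //.
have le_y a v : q v != 0 -> leS (X a v) y -> X a v = y.
  by move=> qv; case: (X_supp a v qv) => -> // le; move: le xy zy wy => -> //.
have ge_w a v : q v != 0 -> leS w (X a v) -> X a v = w.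
  by move=> qv; case: (X_supp a v qv) => -> // le; move: le wx wy wz => -> //.
(* Nested events of equal probability agree off the null outcomes. At the fixed outcome [e], the
   tests for [x], [y] and [w] are thus invariant along comparabilities within [F], [G] and [H]. *)
have same_x a c : leA a c -> F c -> (X a e == x) = (X c e == x).
  move=> ac Fc; apply: esym; apply: (event_eq q_ge0 (E := fun v => X c v == x)
    (F := fun v => X a v == _)) => // [v qv /eqP Xc|].
    by apply/eqP/le_x => //; rewrite -Xc; apply: X_mono.
  by rewrite !X_law !crossed_x Fc (F_anti ac Fc).
have same_y a c : leA a c -> G c -> (X a e == y) = (X c e == y).
  move=> ac Gc; apply: esym; apply: (event_eq q_ge0 (E := fun v => X c v == y)
    (F := fun v => X a v == _)) => // [v qv /eqP Xc|].
    by apply/eqP/le_y => //; rewrite -Xc; apply: X_mono.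
  by rewrite !X_law !crossed_y Gc (G_anti ac Gc).
have same_w a c : leA a c -> H a -> (X a e == w) = (X c e == w).
  move=> ac Ha; apply: (event_eq q_ge0 (E := fun v => X a v == w)
    (F := fun v => X c v == _)) => // [v qv /eqP Xa|].
    by apply/eqP/ge_w => //; rewrite -Xa; apply: X_mono.
  by rewrite !X_law !crossed_w Ha (H_mono ac Ha).
have [linkL [l Ll bl] [l' Ll' l't] nL] := bLt.
have [linkM [m Mm bm] [m' Mm' m't] nM] := bMt.
have FL a : L a -> F a by move=> La; apply/asboolP; exists a.
have GM a : M a -> G a by move=> Ma; apply/asboolP; exists a.
have HL a : L a -> H a by move=> La; apply/asboolP; exists a => //; left.
have HM a : M a -> H a by move=> Ma; apply/asboolP; exists a => //; right.
have X_L a : L a -> (X a e == x) = (X a e != w).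
  move=> La; have Xy : X a e != y.
    apply: X_neq => //; rewrite crossed_y (_ : G a = false) ?mul0r //.
    by apply: contraNF (FGH a) => ->; rewrite FL ?HL.
  have Xz : X a e != z.
    apply: X_neq => //; rewrite /crossed eqxx !distinct (FL a La) (HL a La).
    rewrite (_ : G a = false); first by rewrite /=; lra.
    by apply: contraNF (FGH a) => ->; rewrite FL ?HL.
  case: (X_supp a e qe) Xy Xz => ->; rewrite ?eqxx // => _ _.
    by rewrite distinct.
  by rewrite distinct.
have X_M a : M a -> (X a e == y) = (X a e != w).
  move=> Ma; have Xx : X a e != x.
    apply: X_neq => //; rewrite crossed_x (_ : F a = false) ?mul0r //.
    by apply: contraNF (FGH a) => ->; rewrite GM ?HM.
  have Xz : X a e != z.
    apply: X_neq => //; rewrite /crossed eqxx !distinct (GM a Ma) (HM a Ma).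
    rewrite (_ : F a = false); first by rewrite /=; lra.
    by apply: contraNF (FGH a) => ->; rewrite GM ?HM.
  case: (X_supp a e qe) Xx Xz => ->; rewrite ?eqxx // => _ _.
    by rewrite distinct.
  by rewrite distinct.
have same_L : (X l e == w) = (X l' e == w).
  apply/esym; apply: (linkL (fun a => (X a e == w) = (X l e == w)) _ l l' Ll Ll' erefl) => a c La Lc.
  by case/orP=> ac <-; [rewrite -(same_w a c) ?HL|rewrite -(same_w c a) ?HL].
have same_M : (X m e == w) = (X m' e == w).
  apply/esym; apply: (linkM (fun a => (X a e == w) = (X m e == w)) _ m m' Mm Mm' erefl) => a c Ma Mc.
  by case/orP=> ac <-; [rewrite -(same_w a c) ?HM|rewrite -(same_w c a) ?HM].
have Fb : F b by apply/asboolP; exists l.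
have Gb : G b by apply/asboolP; exists m.
have Hb : H b = false by apply: contraNF (FGH b) => ->; rewrite Fb Gb.
have X_b : (X b e == x) = (X b e != y).
  have Xw : X b e != w by apply: X_neq => //; rewrite crossed_w Hb mul0r.
  have Xz : X b e != z.
    by apply: X_neq => //; rewrite /crossed eqxx !distinct Fb Gb Hb /=; lra.
  case: (X_supp b e qe) Xw Xz => ->; rewrite ?eqxx // => _ _.
    by rewrite distinct.
  by rewrite distinct.
(* Being [x] and being [y] at [b] are both equivalent to not being [w] at [t], yet exactly one of
   them holds. *)
move: X_b; rewrite (same_x b l) ?FL // (same_y b m) ?GM // X_L // X_M // same_L same_M.
by rewrite (same_w l' t) ?HL // (same_w m' t) ?HM //; case: (X t e == w).
Qed.

End Counterexample.

Lemma crossed_system {R : realType} {A S : finType} (leA : rel A) (leS : rel S) (x y z w : S) :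
    reflexive leA -> transitive leA -> reflexive leS -> obstruction leA ->
    [/\ leS x z, leS y z & leS z w] ->
    [/\ ~~ leS y x, ~~ leS z x & ~~ leS w x] ->
    [/\ ~~ leS x y, ~~ leS z y, ~~ leS w y & ~~ leS w z] ->
  exists p : A -> S -> R, [/\ forall a, is_pmf (p a),
    forall (U : pred S) a c, leA a c -> (forall s s', U s -> leS s s' -> U s') ->
      \sum_(s | U s) p a s <= \sum_(s | U s) p c s
    & ~ monotone_coupling leA leS p].
Proof.
move=> leA_refl leA_trans leS_refl [b [t [L [M [LM bLt bMt]]]]].
case=> xz yz zw [yx zx wx] [xy zy wy wz]; exists (@crossed R A S leA x y z w L M); split.
- exact: crossed_pmf.
- by move=> U a c ac; exact: (crossed_mono leA_trans xz yz zw ac).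
- exact: (crossed_no_coupling leA_refl leA_trans leS_refl yx zx wx xy zy wy wz LM bLt bMt).
Qed.

Lemma obstruction_not_equivalent {R : realType} {dA dS : Order.disp_t}
    {A : finPOrderType dA} {S : finPOrderType dS} :
  has_induced_Y S -> obstruction (@Order.le dA A) -> ~ monotonicity_equivalence R A S.
Proof.
move=> indY obsA equiv.
suff [p [p_pmf p_mono nocoupling]] : exists p : A -> S -> R, [/\ forall a, is_pmf (p a),
    forall (U : pred S) a c, (a <= c)%O -> (forall s s', U s -> (s <= s')%O -> U s') ->
      \sum_(s | U s) p a s <= \sum_(s | U s) p c s
    & ~ monotone_coupling <=%O <=%O p].
  have [x0 _] : exists x0 : S, True.
    by case: indY => /has_induced_embedding[g _]; exists (g (ord0 : 'I_4)).
  have [P PE] := choice (fun a => pmf_probability x0 (p_pmf a)).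
  have pE a : pmf_of (P a) =1 p a.
    move=> s; rewrite /pmf_of PE /= (big_pred1 s) // => t.
    by apply/idP/eqP => [/set_mem|->]; [|apply/mem_set].
  have {equiv} := equiv x0 P; case/(_ _)/coupling_of_realizably_monotone => [|T [q [X [q_pmf X_law X_mono]]]].
    apply/stochastically_monotoneP => a c U ac U_up.
    by rewrite !(eq_bigr _ (fun s _ => pE _ s)); apply: p_mono.
  by apply: nocoupling; exists T, q, X; split=> // a s; rewrite X_law pE.
have leYE (p q : Yposet) : (p <= q)%O = ((p : 'I_4) == q) || ((p < q)%N && (2 <= q)%N) by [].
pose y0 : Yposet := @Ordinal 4 0 isT; pose y1 : Yposet := @Ordinal 4 1 isT.
pose y2 : Yposet := @Ordinal 4 2 isT; pose y3 : Yposet := @Ordinal 4 3 isT.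
case: indY => /has_induced_embedding[g g_mono].
  apply: (@crossed_system R A S <=%O <=%O (g y0) (g y1) (g y2) (g y3)) => //.
  - exact: le_trans.
  - by rewrite !g_mono !leYE.
  - by rewrite !g_mono !leYE.
  - by rewrite !g_mono !leYE.
(* For the dual Y-poset both orders are reversed: obstructions are self-dual, and complements turn
   up-sets into up-sets of the reversed order. *)
have dualE p q : (g p <= g q)%O = ((q : Yposet) <= p)%O by rewrite g_mono.
have [||||||p [p_pmf p_mono nocoupling]] := @crossed_system R A S (fun a c => (c <= a)%O)
  (fun s s' => (s' <= s)%O) (g y0) (g y1) (g y2) (g y3) (@lexx _ _).
- by move=> a c e ca ae; apply: le_trans ae ca.
- exact: lexx.
- exact: obstruction_flip obsA.
- by rewrite !dualE !leYE.
- by rewrite !dualE !leYE.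
- by rewrite !dualE !leYE.
exists p; split=> //.
  move=> U a c ac U_up; have := p_mono (predC U) c a ac.
  have split_sum e : \sum_(s | predC U s) p e s = 1 - \sum_(s | U s) p e s.
    by rewrite -(p_pmf e).2 [\sum_s _](bigID U) /= addrC addrK.
  rewrite !split_sum lerD2l lerN2; apply=> s s' /= nUs ss.
  by apply: contra nUs => Us; apply: U_up ss.
case=> T [q [X [q_pmf X_law X_mono]]]; apply: nocoupling; exists T, q, X; split=> //.
by move=> a c v ac; apply: X_mono.
Qed.

(** * Measures on a tree *)

Section Sides.
Context {d : Order.disp_t} {S : finPOrderType d}.
Implicit Types a b s t u x y : S.

Definition other_edges x y : rel S := [rel a b | cover_adj a b &&
  ~~ ((a == x) && (b == y) || (a == y) && (b == x))].

(* When [x] and [y] are adjacent, the component of [y] once the edge between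
   [x] and [y] is deleted from the cover graph. *)
Definition side x y : pred S := connect (other_edges x y) y.

Lemma side_self x y : side x y y. Proof. exact: connect0. Qed.

Lemma side_edge x y a b : cover_adj a b -> side x y a ->
  side x y b \/ (a = x /\ b = y) \/ (a = y /\ b = x).
Proof.
move=> ab y_a; have [ab_xy|ab_xy] := boolP ((a == x) && (b == y) || (a == y) && (b == x)).
  by right; case/orP: ab_xy => /andP[/eqP-> /eqP->]; [left|right].
by left; apply: connect_trans y_a (connect1 _); rewrite /other_edges /= ab.
Qed.

Hypotheses (S_conn : connected_poset S) (S_acyc : acyclic_poset S).

Lemma connected_ind (Z : pred S) : (forall a b, cover_adj a b -> Z a -> Z b) ->
  forall a b, Z a -> Z b.
Proof.
move=> Z_cl a b; have /connectP[p] := S_conn a b.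
by elim: p a => /= [a _ ->//|c p IHp a /andP[ac /IHp IH] /IH + Za]; apply; apply: Z_cl Za.
Qed.

Lemma side_root x y : cover_adj x y -> ~~ side x y x.
Proof.
move=> xy; apply: acyclic_bridge S_acyc _ _ _; first by rewrite cover_adj_sym.
  by move=> a b /andP[].
by rewrite /other_edges /= !eqxx orbT andbF.
Qed.

Lemma side_step x y a b : cover_adj x y -> cover_adj a b -> side x y a ->
  side x y b \/ (a = y /\ b = x).
Proof.
move=> xy ab y_a; case: (side_edge ab y_a) => [|[[ax _]|]]; [by left| |by right].
by rewrite ax (negPf (side_root xy)) in y_a.
Qed.

Lemma side_exists s u : u != s -> exists2 t, cover_adj s t & side s t u.
Proof.
pose Z u := (u == s) || [exists t, cover_adj s t && side s t u].
have : Z u.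
  apply: (@connected_ind Z _ s); last by rewrite /Z eqxx.
  move=> a b ab /orP[/eqP eq_as|/existsP[t /andP[st t_a]]]; apply/orP.
    by right; apply/existsP; exists b; rewrite -eq_as ab side_self.
  case: (side_step st ab t_a) => [t_b|[_ ->]]; last by left.
  by right; apply/existsP; exists t; rewrite st.
by case/orP=> [->//|/existsP[t /andP[]]]; exists t.
Qed.

Lemma side_unique s t t' u : cover_adj s t -> cover_adj s t' ->
  side s t u -> side s t' u -> t = t'.
Proof.
move=> st st' tu tu'; apply: contrapT => /eqP nt.
have := side_root st; apply/negP; rewrite negbK.
have : side s t s && side s t' s.
  apply: (@connected_ind (fun v => side s t v && side s t' v) _ u); last by rewrite tu tu'.
  move=> a b ab /andP[ta ta'].
  case: (side_step st ab ta) (side_step st' ab ta') => [tb|[eq_a eq_b]] [tb'|[eq_a' eq_b']].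
  - by rewrite tb tb'.
  - by rewrite eq_b' (negPf (side_root st)) in tb.
  - by rewrite eq_b (negPf (side_root st')) in tb'.
  - by rewrite -eq_a -eq_a' eqxx in nt.
by case/andP.
Qed.

Lemma sideC x y u : cover_adj x y -> side y x u = ~~ side x y u.
Proof.
move=> xy; have yx : cover_adj y x by rewrite cover_adj_sym.
have cover_u : side x y u || side y x u.
  apply: (@connected_ind (fun v => side x y v || side y x v) _ x); last by rewrite side_self orbT.
  move=> a b ab /orP[y_a|x_a].
    by case: (side_step xy ab y_a) => [->//|[_ ->]]; rewrite side_self orbT.
  by case: (side_step yx ab x_a) => [->|[_ ->]]; rewrite ?side_self ?orbT.
case: (boolP (side x y u)) cover_u => //= y_u _; apply/negP => x_u.
have nux : u != x by apply: contraTneq y_u => ->; apply: side_root.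
move: (side_root xy); apply/negP; rewrite negbK.
have : side x y x && side y x x; last by case/andP.
apply: (@connected_ind (fun v => side x y v && side y x v) _ u); last by rewrite y_u.
move=> a b ab /andP[y_a x_a].
case: (side_step xy ab y_a) => [->|[eq_a _]]; last by rewrite eq_a (negPf (side_root yx)) in x_a.
by case: (side_step yx ab x_a) => [->|[eq_a _]]; last by rewrite eq_a (negPf (side_root xy)) in y_a.
Qed.

Lemma covers_adj x y : covers y x -> cover_adj x y.
Proof. by move=> cov; rewrite /cover_adj /= cov orbT. Qed.

Lemma side_up x y s t : covers y x -> side x y s -> (s <= t)%O -> side x y t.
Proof.
move=> cov /[swap]; apply: (cover_chain_ind (r := fun s t => side x y s -> side x y t)) => //.
  by move=> u v w uv vw /uv/vw.
move=> u v _ _ uv y_u; case: (side_step (covers_adj cov) (covers_adj uv) y_u) => // -[eq_u eq_v].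
move: (covers_lt cov) (covers_lt uv); rewrite eq_u eq_v => xy yx.
by have := lt_trans xy yx; rewrite ltxx.
Qed.

Section Mass.
Context {R : realType}.
Implicit Types (m : S -> R) (eta : S -> S -> R).

Definition mass m x y : R := \sum_(u | side x y u) m u.

(** Net flow into [s] when [eta x y] is carried up each cover edge. *)
Definition divergence eta s : R :=
  \sum_(x | covers s x) eta x s - \sum_(y | covers y s) eta s y.

(** The branches at [s], one per neighbour, partition the other vertices. *)
Lemma mass_neighbours m s :
  \sum_(t | cover_adj s t) mass m s t = \sum_(u | u != s) m u.
Proof.
rewrite (exchange_big_dep (fun u => u != s)) /=; last first.
  by move=> t u st; apply: contraTneq => ->; apply: side_root.
apply: eq_bigr => u us; have [t st tu] := side_exists us.
rewrite (big_pred1 t) // => t' /=.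
apply/andP/eqP => [[st' tu']|->//]; exact: side_unique tu' tu.
Qed.

Lemma massC m x y : cover_adj x y -> \sum_s m s = 0 -> mass m y x = - mass m x y.
Proof.
move=> xy; rewrite (bigID (side x y)) /= => sum0.
apply/eqP; rewrite -addr_eq0 addrC; apply/eqP; rewrite -[RHS]sum0; congr (_ + _).
by apply: eq_bigl => u; apply: sideC.
Qed.

(** With total mass zero the branches at [s] weigh [- m s] together; [massC] turns those towards
    lower neighbours into inflow. *)
Lemma divergence_mass m s : \sum_s m s = 0 -> m s = divergence (mass m) s.
Proof.
move=> sum0; have := mass_neighbours m s.
have -> : \sum_(u | u != s) m u = - m s.
  by apply/eqP; rewrite -addr_eq0 addrC; apply/eqP; rewrite -[RHS]sum0 [RHS](bigD1 s).
rewrite (bigID (covers s)) /= => sumE; rewrite -[LHS]opprK -sumE opprD; congr (_ + _).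
  rewrite -sumrN; apply: eq_big => [t|t /andP[st ts]].
    by rewrite /cover_adj /=; case: (covers s t); rewrite ?andbF ?andbT.
  by rewrite massC ?opprK // cover_adj_sym.
congr (- _); apply: eq_bigl => t; rewrite /cover_adj /=.
have [st|] /= := boolP (covers s t); last by rewrite andbT.
by apply/esym/negP => /covers_lt ts; have := lt_trans ts (covers_lt st); rewrite ltxx.
Qed.

(** Summation by parts: only edges crossing the boundary of [U] contribute. *)
Lemma sum_divergence eta (U : pred S) : \sum_(s | U s) divergence eta s =
  \sum_x \sum_(y | covers y x) eta x y * ((U y)%:R - (U x)%:R).
Proof.
have -> : \sum_(s | U s) divergence eta s =
    \sum_(s | U s) \sum_(x | covers s x) eta x s - \sum_(s | U s) \sum_(y | covers y s) eta s y.
  by rewrite -sumrB.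
have -> : \sum_x \sum_(y | covers y x) eta x y * ((U y)%:R - (U x)%:R) =
    \sum_x \sum_(y | covers y x) eta x y * (U y)%:R -
    \sum_x \sum_(y | covers y x) eta x y * (U x)%:R.
  by rewrite -sumrB; apply: eq_bigr => x _; rewrite -sumrB; apply: eq_bigr => y _; rewrite mulrBr.
congr (_ - _).
  rewrite [RHS](exchange_big_dep xpredT) //= big_mkcond; apply: eq_bigr => s _.
  case: (U s); first by apply: eq_bigr => x _; rewrite mulr1.
  by rewrite big1 // => x _; rewrite mulr0.
rewrite big_mkcond; apply: eq_bigr => s _.
case: (U s); first by apply: eq_bigr => x _; rewrite mulr1.
by rewrite big1 // => x _; rewrite mulr0.
Qed.

(** The given edge is the only one crossing the boundary of its side. Together with
    [divergence_mass], this makes edge masses free coordinates on the functions of total mass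
    zero. *)
Lemma mass_divergence eta x y : covers y x -> mass (divergence eta) x y = eta x y.
Proof.
move=> cov; rewrite /mass sum_divergence (bigD1 x) //= (bigD1 y) //=.
have sxF := negPf (side_root (covers_adj cov)); rewrite side_self sxF subr0 mulr1.
have same u v : covers v u -> (u != x) || (v != y) -> side x y v = side x y u.
  move=> uv ne; have adj := covers_adj uv; have xy := covers_adj cov.
  have no_flip : (u = y -> v = x -> False).
    move=> eq_u eq_v; rewrite eq_u eq_v in uv.
    by have := lt_trans (covers_lt cov) (covers_lt uv); rewrite ltxx.
  apply/idP/idP => [sv|su].
    have adj' : cover_adj v u by rewrite cover_adj_sym.
    case: (side_step xy adj' sv) => // -[eq_v eq_u].
    by rewrite eq_u eq_v !eqxx in ne.
  by case: (side_step xy adj su) => // -[eq_u eq_v]; case: no_flip.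
rewrite big1 ?addr0 => [|v /andP[xv vy]]; last first.
  by rewrite (same x) ?vy ?orbT // sxF subrr mulr0.
rewrite big1 ?addr0 // => u ux; rewrite big1 // => v uv.
by rewrite (same u) ?ux // subrr mulr0.
Qed.

Lemma sum_divergence0 eta : \sum_s divergence eta s = 0.
Proof.
rewrite (sum_divergence eta xpredT) big1 // => x _; rewrite big1 // => y _.
by rewrite subrr mulr0.
Qed.

End Mass.

End Sides.

Section MassLinear.
Context {d : Order.disp_t} {S : finPOrderType d} {R : realType}.
Implicit Types (p q : S -> R) (eta : S -> S -> R).

Lemma massB p q x y : mass (fun s => q s - p s) x y = mass q x y - mass p x y.
Proof. by rewrite /mass sumrB. Qed.

Lemma massD p q x y : mass (fun s => q s + p s) x y = mass q x y + mass p x y.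
Proof. by rewrite /mass big_split. Qed.

Lemma divergenceB eta eta' s :
  divergence (fun x y => eta x y - eta' x y) s = divergence eta s - divergence eta' s.
Proof. by rewrite /divergence !sumrB; lra. Qed.

Definition mass_le p q : Prop := forall x y, covers y x -> mass p x y <= mass q x y.

End MassLinear.

Section Kernel.
Context {d : Order.disp_t} {S : finPOrderType d} {R : realType}.
Hypotheses (S_conn : connected_poset S) (S_acyc : acyclic_poset S).

Definition is_kernel (K : S -> S -> R) : Prop :=
  (forall s, is_pmf (K s)) /\ (forall s t, K s t != 0 -> (s <= t)%O).

Lemma sum_delta (T : finType) (f : T -> R) (t0 : T) : \sum_t f t * (t == t0)%:R = f t0.
Proof.
rewrite (bigD1 t0) //= eqxx mulr1 big1 ?addr0 // => t /negPf ->.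
by rewrite mulr0.
Qed.

Lemma id_kernel : is_kernel (fun s t => (t == s)%:R).
Proof.
split=> [s|s t]; last by case: (eqVneq t s) => [->|_]; rewrite ?lexx ?eqxx.
split=> [t|]; first by rewrite ler0n.
by rewrite -[RHS](sum_delta (fun=> 1) s); apply: eq_bigr => t _; rewrite mul1r.
Qed.

Lemma comp_kernel K K' : is_kernel K -> is_kernel K' ->
  is_kernel (fun s t => \sum_u K s u * K' u t).
Proof.
case=> K_pmf K_le [K'_pmf K'_le]; split=> [s|s t].
  split=> [t|]; first by rewrite sumr_ge0 // => u _; rewrite mulr_ge0 ?(K_pmf _).1 ?(K'_pmf _).1.
  rewrite exchange_big -(K_pmf s).2; apply: eq_bigr => u _.
  by rewrite -mulr_sumr (K'_pmf u).2 mulr1.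
apply: contraNT => nst; rewrite big1 ?eqxx // => u _; apply/eqP.
apply: contraNT nst; rewrite mulf_eq0 negb_or => /andP[/K_le su /K'_le ut].
exact: le_trans ut.
Qed.

Lemma move_kernel (x y : S) (a : R) : (x < y)%O -> 0 <= a <= 1 ->
  is_kernel (fun s t => (t == s)%:R + (s == x)%:R * a * ((t == y)%:R - (t == x)%:R)).
Proof.
move=> xy /andP[a0 a1]; have nxy := lt_eqF xy; split=> [s|s t]; last first.
  case: (eqVneq t s) => [->//|_]; case: (eqVneq s x) => [->|_]; last by rewrite !mul0r addr0 eqxx.
  case: (eqVneq t y) => [->|_]; first by rewrite ltW.
  case: (eqVneq t x) => [->//|_]; by rewrite subrr mulr0 addr0 eqxx.
split=> [t|].
  case: (eqVneq s x) => [->|_]; last by rewrite !mul0r addr0 ler0n.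
  case: (eqVneq t x) => [->|_]; first by rewrite nxy /=; lra.
  by case: (t == y) => /=; lra.
rewrite big_split /= (id_kernel.1 s).2 -mulr_sumr sumrB.
by rewrite (id_kernel.1 x).2 (id_kernel.1 y).2 subrr mulr0 addr0.
Qed.

(* Strassen's theorem on a tree: repeatedly move the missing mass up one edge,
   starting from the lowest edges so that the mass is available. *)
Lemma mass_le_kernel (p q : S -> R) : is_pmf p -> is_pmf q -> mass_le p q ->
  exists2 K, is_kernel K & forall t, \sum_s p s * K s t = q t.
Proof.
have [n] := ubnP #|[pred e : S * S | covers e.2 e.1 && (mass p e.1 e.2 < mass q e.1 e.2)]|.
elim: n p => // n IHn p lt_n p_pmf q_pmf pq.
have sum0 : \sum_s (q s - p s) = 0 by rewrite sumrB p_pmf.2 q_pmf.2 subrr.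
have qpE s : q s - p s = divergence (fun x y => mass q x y - mass p x y) s.
  rewrite (divergence_mass S_conn S_acyc s sum0) /divergence; congr (_ - _);
    by apply: eq_bigr => x _; rewrite massB.
pose growing (e : S * S) := covers e.2 e.1 && (mass p e.1 e.2 < mass q e.1 e.2).
have [e0 grow0|nogrow] := pickP growing; last first.
  have same x y : covers y x -> mass q x y - mass p x y = 0.
    move=> cov; have := nogrow (x, y); rewrite /growing /= cov ltNge => /negbFE le_qp.
    by apply/eqP; rewrite subr_eq0 eq_le le_qp pq.
  exists (fun s t => (t == s)%:R) => [|t]; first exact: id_kernel.
  transitivity (\sum_s p s * (s == t)%:R); first by apply: eq_bigr => s _; rewrite eq_sym.
  rewrite sum_delta; apply/eqP; rewrite -subr_eq0 -opprB oppr_eq0 qpE /divergence.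
  rewrite big1 => [|x xt]; last by rewrite same.
  by rewrite big1 ?subrr ?eqxx // => y ty; rewrite same.
(* The lower end [x] is chosen with fewest points below it, so the edges entering [x] are already
   balanced. The balance at [x] then gives [delta <= p x]. *)
case: (arg_minnP (fun e : S * S => #|[pred z | (z < e.1)%O]|) grow0) => -[x y] /= /andP[/= cov grow] min_x.
have flat_below z : covers x z -> mass q z x - mass p z x = 0.
  move=> zx; apply/eqP; rewrite subr_eq0 eq_le pq // andbT leNgt; apply/negP => grow_z.
  have := min_x (z, x); rewrite /growing /= zx grow_z => /(_ isT); apply/negP; rewrite -ltnNge.
  apply: proper_card; apply/fintype.properP; split.
    apply/fintype.subsetP => t; rewrite !inE => tz; exact: lt_trans tz (covers_lt zx).
  by exists z; rewrite !inE ?ltxx //; apply: covers_lt zx.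
set delta := mass q x y - mass p x y.
have delta_gt0 : 0 < delta by rewrite subr_gt0.
have delta_le : delta <= p x.
  have /eqP := qpE x; rewrite /divergence big1 // sub0r (bigD1 y) //= -/delta => /eqP qx.
  have : 0 <= \sum_(i | covers i x && (i != y)) (mass q x i - mass p x i).
    by apply: sumr_ge0 => z /andP[xz _]; rewrite subr_ge0 pq.
  by have := q_pmf.1 x; lra.
have px_gt0 : 0 < p x by apply: lt_le_trans delta_le.
pose eta (u v : S) : R := delta * ((u == x) && (v == y))%:R.
pose p' s := p s + divergence eta s.
have etaE s : divergence eta s = delta * ((s == y)%:R - (s == x)%:R).
  rewrite /divergence mulrBr; congr (_ - _).
    case: (eqVneq s y) => [->|sy]; last first.
      by rewrite mulr0 big1 // => u _; rewrite /eta (negPf sy) andbF mulr0.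
    rewrite (bigD1 x) //= /eta !eqxx big1 ?addr0 // => u /andP[_ /negPf ->].
    by rewrite mulr0.
  case: (eqVneq s x) => [->|sx]; last first.
    by rewrite mulr0 big1 // => u _; rewrite /eta (negPf sx) mulr0.
  rewrite (bigD1 y) //= /eta !eqxx big1 ?addr0 // => u /andP[_ /negPf ->].
  by rewrite andbF mulr0.
have mass_p' u v : covers v u -> mass p' u v = mass p u v + eta u v.
  by move=> uv; rewrite /p' massD (mass_divergence S_acyc).
have p'_pmf : is_pmf p'.
  split=> [s|]; last by rewrite big_split /= p_pmf.2 sum_divergence0 addr0.
  rewrite /p' etaE; have := p_pmf.1 s.
  case: (eqVneq s x) => [->|_]; first by rewrite (lt_eqF (covers_lt cov)) /=; lra.
  by case: (s == y) => /=; lra.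
have etaF u v : ~~ ((u == x) && (v == y)) -> eta u v = 0.
  by rewrite /eta => /negPf ->; rewrite mulr0.
have p'q : mass_le p' q.
  move=> u v uv; rewrite mass_p' //.
  have [/andP[/eqP-> /eqP->]|nuv] := boolP ((u == x) && (v == y)).
    by rewrite /eta !eqxx mulr1 /delta addrC subrK.
  by rewrite etaF // addr0 pq.
have [|K K_ker p'K] := IHn p' _ p'_pmf q_pmf p'q.
  rewrite -ltnS; apply: leq_ltn_trans lt_n; apply: proper_card.
  apply/fintype.properP; split.
    apply/fintype.subsetP => -[u v]; rewrite !inE /= => /andP[uv]; rewrite uv mass_p' // => lt_uv.
    by apply: le_lt_trans lt_uv; rewrite lerDl /eta mulr_ge0 ?ler0n // ltW.
  exists (x, y); rewrite !inE /= cov ?grow //= mass_p' // /eta !eqxx mulr1.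
  by rewrite /delta addrC subrK ltxx.
(* The fraction of the mass at [x] that is sent to [y]; the remaining deficit is left to the
   induction, on one growing edge fewer at least. *)
have a01 : 0 <= delta / p x <= 1.
  by rewrite ler_pdivrMr // mul1r delta_le andbT; apply: divr_ge0; apply: ltW.
exists (fun s t => \sum_u ((u == s)%:R + (s == x)%:R * (delta / p x) * ((u == y)%:R - (u == x)%:R))
           * K u t).
  exact: comp_kernel (move_kernel (covers_lt cov) a01) K_ker.
move=> t; rewrite -p'K.
under eq_bigr do rewrite mulr_sumr.
rewrite exchange_big /=; apply: eq_bigr => u _.
under eq_bigr do rewrite mulrA.
rewrite -mulr_suml; congr (_ * _); rewrite /p' etaE.
under eq_bigr do rewrite mulrDr.
rewrite big_split /=; congr (_ + _).
  by rewrite -[RHS](sum_delta p); apply: eq_bigr => s _; rewrite eq_sym.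
transitivity (\sum_s (p s * (delta / p x) * ((u == y)%:R - (u == x)%:R)) * (s == x)%:R).
  by apply: eq_bigr => s _; ring.
by rewrite sum_delta; field; rewrite gt_eqF.
Qed.

End Kernel.

(** Distinct lower covers of [s] are incomparable, and so are distinct upper covers of [t]; two of
    each would form an induced bowtie. *)
Lemma no_bowtie {d : Order.disp_t} {S : finPOrderType d} (s t x1 x2 y1 y2 : S) :
  ~ has_induced S bowtie -> (s <= t)%O -> covers s x1 -> covers s x2 ->
  covers y1 t -> covers y2 t -> (x1 == x2) || (y1 == y2).
Proof.
move=> nobow st x1s x2s ty1 ty2; apply: contrapT => /negP; rewrite negb_or => /andP[nx ny].
have incomp (a b c : S) : covers a b -> covers a c -> b != c -> (b <= c)%O = false.
  move=> ab ac nbc; apply/negP => bc; case: (covers_between ab bc (ltW (covers_lt ac))) => eq_c.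
    by rewrite eq_c eqxx in nbc.
  by have := covers_lt ac; rewrite eq_c ltxx.
have incomp' (a b c : S) : covers b a -> covers c a -> b != c -> (b <= c)%O = false.
  move=> ab ac nbc; apply/negP => bc; case: (covers_between ac (ltW (covers_lt ab)) bc) => eq_b.
    by have := covers_lt ab; rewrite eq_b ltxx.
  by rewrite eq_b eqxx in nbc.
have xy x y : covers s x -> covers y t -> ((x <= y)%O = true) * ((y <= x)%O = false).
  move=> xs ty; have lt_xy : (x < y)%O.
    by apply: lt_le_trans (covers_lt xs) (le_trans st (ltW (covers_lt ty))).
  by rewrite (lt_geF lt_xy) (ltW lt_xy).
apply: nobow; apply: (@embedding_has_induced _ _ S bowtie
  (fun p : bowtie => nth y2 [:: x1; x2; y1] (p : 'I_4))).
have leE (p q : bowtie) :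
  (p <= q)%O = ((p : 'I_4) == q) || ((p < 2)%N && (2 <= q)%N) by [].
move=> [p p4] [q q4]; rewrite leE -val_eqE /=.
have nx' : x2 != x1 by rewrite eq_sym.
have ny' : y2 != y1 by rewrite eq_sym.
have table := (incomp _ _ _ x1s x2s nx, incomp _ _ _ x2s x1s nx',
  incomp' _ _ _ ty1 ty2 ny, incomp' _ _ _ ty2 ty1 ny', (xy _ _ x1s ty1, xy _ _ x1s ty2,
  xy _ _ x2s ty1, xy _ _ x2s ty2)).
by case: p p4 => [|[|[|[|]]]] // _; case: q q4 => [|[|[|[|]]]] //= _; rewrite ?lexx ?table.
Qed.

Section Interpolation.
Context {d : Order.disp_t} {S : finPOrderType d} {R : realType}.
Hypotheses (S_conn : connected_poset S) (S_acyc : acyclic_poset S).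
Hypothesis S_nobow : ~ has_induced S bowtie.
Context {K : finType} (P : K -> S -> R) (I J : pred K) (i0 j0 : K).
Hypothesis P_pmf : forall k, is_pmf (P k).
Hypotheses (Ii0 : I i0) (Jj0 : J j0).
Hypothesis IJ : forall i j, I i -> J j -> mass_le (P i) (P j).

Let below_fork (s : S) : bool := [exists t, [exists y1, [exists y2,
  [&& (s <= t)%O, covers y1 t, covers y2 t & y1 != y2]]]].

Let low x y : K := [arg max_(i > i0 | I i) mass (P i) x y]%O.
Let high x y : K := [arg min_(j < j0 | J j) mass (P j) x y]%O.
(* At a vertex under a fork there is at most one lower cover, so the minimum of
   the upper family there keeps the mass nonnegative; elsewhere there is at most
   one upper cover and the maximum of the lower family does. *)
Let level x y : R := mass (P (if below_fork y then high x y else low x y)) x y.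

Let highP x y : J (high x y) /\ forall j, J j -> mass (P (high x y)) x y <= mass (P j) x y.
Proof. by rewrite /high; case: Order.TotalTheory.arg_minP. Qed.

Let lowP x y : I (low x y) /\ forall i, I i -> mass (P i) x y <= mass (P (low x y)) x y.
Proof. by rewrite /low; case: Order.TotalTheory.arg_maxP. Qed.

Let le_level i x y : I i -> covers y x -> mass (P i) x y <= level x y.
Proof.
move=> Ii xy; rewrite /level; case: ifP => _; last exact: (lowP x y).2.
by apply: IJ xy => //; apply: (highP x y).1.
Qed.

Let level_le j x y : J j -> covers y x -> level x y <= mass (P j) x y.
Proof.
move=> Jj xy; rewrite /level; case: ifP => _; first exact: (highP x y).2.
by apply: IJ xy => //; apply: (lowP x y).1.
Qed.

Lemma interpolation : exists2 r : S -> R, is_pmf r &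
  (forall i, I i -> mass_le (P i) r) /\ (forall j, J j -> mass_le r (P j)).
Proof.
pose r s := P i0 s + divergence (fun x y => level x y - mass (P i0) x y) s.
(* The measure [r] can be expanded from any member of the family, so nonnegativity at [s] may be
   checked from a [k] suited to [s]. *)
have rE k s : r s = P k s + divergence (fun x y => level x y - mass (P k) x y) s.
  have sum0 : \sum_s (P k s - P i0 s) = 0 by rewrite sumrB !(P_pmf _).2 subrr.
  have := divergence_mass S_conn S_acyc s sum0.
  have -> : divergence (mass (fun s => P k s - P i0 s)) s =
      divergence (fun x y => mass (P k) x y - mass (P i0) x y) s.
    by rewrite /divergence; congr (_ - _); apply: eq_bigr => x _; rewrite massB.
  by rewrite /r !divergenceB; lra.
have mass_r x y : covers y x -> mass r x y = level x y.
  by move=> xy; rewrite /r massD (mass_divergence S_acyc) // addrC subrK.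
exists r; last first.
  by split=> k Kk x y xy; rewrite mass_r //; [apply: le_level|apply: level_le].
split=> [s|]; last by rewrite big_split /= (P_pmf i0).2 sum_divergence0 addr0.
have [/existsP[t /existsP[y1 /existsP[y2 /and4P[st ty1 ty2 ny]]]]|nfork] := boolP (below_fork s).
  have fork_s : below_fork s.
    by apply/existsP; exists t; apply/existsP; exists y1; apply/existsP; exists y2; apply/and4P.
  (* With [k] attaining the minimum on the only lower edge, the inflow vanishes, and the flow on
     every upper edge is nonpositive because [k] is in [J]. *)
  have [k Jk flat] : exists2 k, J k & \sum_(x | covers s x) (level x s - mass (P k) x s) = 0.
    have [x0 x0s|nolow] := pickP (covers s); last first.
      by exists j0 => //; rewrite big_pred0.
    exists (high x0 s); first exact: (highP _ _).1.
    rewrite (big_pred1 x0) => [|x]; first by rewrite /level fork_s subrr.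
    apply/idP/eqP => [xs|->//]; apply/eqP.
    by have := no_bowtie S_nobow st xs x0s ty1 ty2; rewrite (negPf ny) orbF.
  rewrite (rE k) /divergence flat sub0r subr_ge0 (le_trans _ ((P_pmf k).1 s)) //.
  by apply: sumr_le0 => y sy; rewrite subr_le0 level_le.
(* Two upper covers of [s] would make a fork at [s] itself, so there is at most one. It is not under
   a fork either, hence its edge has the maximal level. *)
have [k Ik flat] : exists2 k, I k & \sum_(y | covers y s) (level s y - mass (P k) s y) = 0.
  have [y0 sy0|noup] := pickP (fun y => covers y s); last first.
    by exists i0 => //; rewrite big_pred0.
  exists (low s y0); first exact: (lowP _ _).1.
  rewrite (big_pred1 y0) => [|y].
    rewrite /level ifF ?subrr //; apply: contraNF nfork => /existsP[t /existsP[y1 /existsP[y2]]].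
    case/and4P=> y0t ty1 ty2 ny; apply/existsP; exists t; apply/existsP; exists y1.
    apply/existsP; exists y2; rewrite ty1 ty2 ny !andbT.
    exact: le_trans (ltW (covers_lt sy0)) y0t.
  apply/idP/eqP => [sy|->//]; apply: contrapT => /eqP ny; move/negP: nfork; apply.
  by apply/existsP; exists s; apply/existsP; exists y; apply/existsP; exists y0; rewrite lexx sy sy0.
rewrite (rE k) /divergence flat subr0 addr_ge0 ?(P_pmf k).1 //.
by apply: sumr_ge0 => x xs; rewrite subr_ge0 le_level.
Qed.

End Interpolation.

(** * Gluing kernels along a forest *)

Section Gluing.
Context {R : realType} {dB dS : Order.disp_t}.
Context {B : finPOrderType dB} {S : finPOrderType dS}.
Variable p : B -> S -> R.
Hypothesis p_pmf : forall b, is_pmf (p b).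

Definition realizes {T : finType} (q : T -> R) (X : B -> T -> S) : Prop :=
  is_pmf q /\ forall b s, \sum_(w | X b w == s) q w = p b s.

Lemma product_realizes :
  realizes (fun f : {ffun B -> S} => \prod_b p b (f b)) (fun b (f : {ffun B -> S}) => f b).
Proof.
split.
  split=> [f|]; first by apply: prodr_ge0 => b _; apply: (p_pmf b).1.
  by rewrite -bigA_distr_bigA big1 // => b _; apply: (p_pmf b).2.
move=> b s; rewrite big_mkcond /=.
transitivity (\prod_c \sum_t p c t * (if c == b then (t == s)%:R else 1)).
  rewrite bigA_distr_bigA; apply: eq_bigr => f _; rewrite big_split /=.
  rewrite [\prod_c (if _ then _ else _)](bigD1 b) //= eqxx.
  rewrite [\prod_(c | c != b) (if _ then _ else _)]big1 => [|c /negPf ->//].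
  by case: (f b == s); rewrite ?mulr1 ?mulr0.
rewrite (bigD1 b) //= eqxx sum_delta big1 ?mulr1 // => c /negPf ->.
by under eq_bigr do rewrite mulr1; apply: (p_pmf c).2.
Qed.

Lemma realizes_expect {T : finType} (q : T -> R) (X : B -> T -> S) b (h : S -> R) :
  realizes q X -> \sum_w q w * h (X b w) = \sum_s p b s * h s.
Proof.
case=> _ X_law; under [RHS]eq_bigr do rewrite -X_law mulr_suml.
rewrite (exchange_big_dep xpredT) //=; apply: eq_bigr => w _.
by rewrite (big_pred1 (X b w)) // => s; rewrite /= eq_sym.
Qed.

Lemma realizes_support {T : finType} (q : T -> R) (X : B -> T -> S) b w :
  realizes q X -> q w != 0 -> p b (X b w) != 0.
Proof.
case=> [[q_ge0 _] X_law] qw; rewrite -X_law psumr_neq0 //; apply/hasP.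
by exists w; rewrite ?mem_index_enum //= eqxx lt0r qw q_ge0.
Qed.

Section Step.
Context {T : finType} (q : T -> R) (X : B -> T -> S) (b c : B) (K : S -> S -> R).
Hypotheses (qX : realizes q X) (K_ker : is_kernel K).
Hypothesis pK : forall t, \sum_s p b s * K s t = p c t.

Let q_ge0 : forall w, 0 <= q w. Proof. exact: qX.1.1. Qed.
Let p_ge0 : forall b s, 0 <= p b s. Proof. by move=> b' s; apply: (p_pmf b').1. Qed.
Let K_ge0 : forall s t, 0 <= K s t. Proof. by move=> s t; apply: (K_ker.1 s).1. Qed.

(* Two independent copies of the realization, coupled through the kernel at
   [b] in the first copy and [c] in the second. *)
Definition glued (fg : T * T) : R :=
  q fg.1 * q fg.2 * K (X b fg.1) (X c fg.2) / p c (X c fg.2).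

Lemma glued_ge0 fg : 0 <= glued fg.
Proof. by rewrite /glued !mulr_ge0 ?invr_ge0. Qed.

Lemma glued_fst f : \sum_g glued (f, g) = q f.
Proof.
have [qf|qf] := eqVneq (q f) 0.
  by rewrite big1 ?qf // => g _; rewrite /glued /= qf !mul0r.
transitivity (q f * \sum_g q g * (K (X b f) (X c g) / p c (X c g))).
  by rewrite mulr_sumr; apply: eq_bigr => g _; rewrite /glued /= !mulrA.
rewrite (realizes_expect c (fun t => K (X b f) t / p c t) qX) -[RHS]mulr1.
rewrite -(K_ker.1 (X b f)).2; congr (_ * _); apply: eq_bigr => t _.
have [pt|pt] := eqVneq (p c t) 0; last by field.
(* The quotient is zero when [p c t = 0]. This is consistent: [p b (X b f)] is nonzero, so [pK]
   forces the kernel entry to vanish. *)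
rewrite pt mul0r; apply/esym/eqP; move: pt; rewrite -pK => /eqP.
rewrite psumr_eq0 => [|s _]; last by rewrite mulr_ge0.
move/allP=> /(_ (X b f) (mem_index_enum _)) /=; rewrite mulf_eq0.
by rewrite (negPf (realizes_support b qX qf)).
Qed.

Lemma glued_snd g : \sum_f glued (f, g) = q g.
Proof.
have [qg|qg] := eqVneq (q g) 0.
  by rewrite big1 ?qg // => f _; rewrite /glued /= qg mulr0 !mul0r.
transitivity ((\sum_f q f * K (X b f) (X c g)) * (q g / p c (X c g))).
  by rewrite mulr_suml; apply: eq_bigr => f _; rewrite /glued /=; ring.
rewrite (realizes_expect b (fun s => K s (X c g)) qX) pK.
by field; apply: realizes_support qX qg.
Qed.

(** Both marginals of [glued] are [q], so each vertex may read either copy without changing its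
    law. *)
Lemma glued_realizes (Z : pred B) :
  realizes glued (fun v fg => if Z v then X v fg.1 else X v fg.2).
Proof.
split.
  split; first exact: glued_ge0.
  by rewrite -(pair_bigA _ (fun f g => glued (f, g))) /= -qX.1.2; apply: eq_bigr => f _; apply: glued_fst.
move=> v s; rewrite -qX.2; case: (Z v).
  rewrite big_mkcond -(pair_bigA _ (fun f g => if X v f == s then glued (f, g) else 0)) /=.
  rewrite [RHS]big_mkcond; apply: eq_bigr => f _.
  by case: (X v f == s); [apply: glued_fst|rewrite big1].
rewrite big_mkcond -(pair_bigA _ (fun f g => if X v g == s then glued (f, g) else 0)) /=.
rewrite exchange_big [RHS]big_mkcond; apply: eq_bigr => g _.
by case: (X v g == s); [apply: glued_snd|rewrite big1].
Qed.

Lemma glued_support f g : glued (f, g) != 0 ->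
  [/\ q f != 0, q g != 0 & (X b f <= X c g)%O].
Proof.
rewrite /glued /= !mulf_eq0 !negb_or => /andP[/andP[/andP[qf qg] K_neq0] _].
by split=> //; apply: K_ker.2.
Qed.

End Step.

Lemma forest_realizes (E : seq (B * B)) : acyclic_poset B -> uniq E ->
    (forall e, e \in E -> covers e.2 e.1) ->
    (forall e, e \in E -> exists2 K, is_kernel K & forall t, \sum_s p e.1 s * K s t = p e.2 t) ->
  exists (T : finType) (q : T -> R) (X : B -> T -> S), realizes q X /\
    forall e w, e \in E -> q w != 0 -> (X e.1 w <= X e.2 w)%O.
Proof.
move=> acyc; elim: E => [_ _ _|[b c] E IHE /= /andP[bcE uE] E_cov E_ker].
  by do 3 eexists; split; first exact: product_realizes.
have covE e : e \in E -> covers e.2 e.1 by move=> eE; apply: E_cov; rewrite inE eE orbT.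
have [e eE|T [q [X [qX X_mono]]]] := IHE uE covE; first by apply: E_ker; rewrite inE eE orbT.
have bc : covers c b by apply: (E_cov (b, c)); rewrite inE eqxx.
have [K K_ker pK] := E_ker (b, c) (mem_head _ _).
pose r : rel B := [rel u v | ((u, v) \in E) || ((v, u) \in E)].
have r_sym : symmetric r by move=> u v; rewrite /r /= orbC.
(* The component of [b] in the forest built so far reads the first copy and all the rest the second,
   so earlier edges stay within one copy. *)
pose Z : pred B := connect r b.
have nZc : ~~ Z c.
  apply: (acyclic_bridge acyc (covers_adj bc)) => [u v /orP[] /covE /= uv|].
  - exact: covers_adj.
  - by rewrite cover_adj_sym covers_adj.
  rewrite /r /= (negPf bcE) /=; apply/negP => /covE /= cb.
  by have := lt_trans (covers_lt bc) (covers_lt cb); rewrite ltxx.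
have Z_E u v : (u, v) \in E -> Z u = Z v.
  move=> uv; apply: (same_connect_r (sym_connect_sym r_sym)).
  by apply: connect1; rewrite /r /= uv.
exists (T * T)%type, (glued q X b c K), (fun v fg => if Z v then X v fg.1 else X v fg.2).
split=> [|[u v] [f g]]; first exact: glued_realizes.
rewrite inE => /predU1P[[-> ->]|uv] /= /(glued_support K_ker)[qf qg bf_cg].
  by rewrite /Z connect0 -/(Z c) (negPf nZc).
by rewrite (Z_E u v uv); case: (Z v); apply: (X_mono (u, v)).
Qed.

End Gluing.

(** * Extension of a system to the convex hull, and the resulting coupling *)

Section Sufficiency.
Context {R : realType} {dA dB dS : Order.disp_t}.
Context {A : finPOrderType dA} {B : finPOrderType dB} {S : finPOrderType dS}.
Hypotheses (S_conn : connected_poset S) (S_acyc : acyclic_poset S).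
Hypothesis S_nobow : ~ has_induced S bowtie.
Hypothesis B_acyc : acyclic_poset B.
Variable i : A -> B.
Hypothesis i_mono : forall a c, (i a <= i c)%O = (a <= c)%O.

(* Outside the convex hull of [A] the system need not extend, since [S] may have
   no least or greatest element. *)
Definition in_hull (b : B) : bool := [exists a, (i a <= b)%O] && [exists a, (b <= i a)%O].

(** Points are added one at a time, interpolating between the measures already fixed below and
    above. Lying in the hull makes both families nonempty. *)
Lemma extend_system (x0 : S) (p : A -> S -> R) : (forall a, is_pmf (p a)) ->
    (forall a c, (a <= c)%O -> mass_le (p a) (p c)) ->
  forall l : seq B, all in_hull l -> exists p' : B -> S -> R,
    [/\ forall b, is_pmf (p' b), forall a, p' (i a) = p a
      & forall b c, (b \in codom i) || (b \in l) -> (c \in codom i) || (c \in l) ->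
          (b <= c)%O -> mass_le (p' b) (p' c)].
Proof.
move=> p_pmf p_mono; have i_inj : injective i.
  by move=> a c eq_i; apply: le_anti; rewrite -!i_mono eq_i lexx.
elim=> [_|b l IHl /= /andP[b_hull /IHl[p' [p'_pmf p'_ext p'_mono]]]].
  (* Off the image of [A] the point mass is a placeholder, replaced when the point is treated;
     monotonicity is claimed only among treated points. *)
  pose p' b := if [pick a | i a == b] is Some a then p a else fun s => (s == x0)%:R.
  have p'_ext a : p' (i a) = p a.
    rewrite /p'; case: pickP => [a' /eqP /i_inj -> //|/(_ a)]; by rewrite eqxx.
  exists p'; split=> // [b|b c].
    by rewrite /p'; case: pickP => [a _|_]; [exact: p_pmf|exact: (@id_kernel _ S R).1].
  rewrite !in_nil !orbF => /codomP[a ->] /codomP[a' ->].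
  by rewrite i_mono !p'_ext; apply: p_mono.
pose D c := (c \in codom i) || (c \in l).
have [Db|nDb] := boolP (D b).
  exists p'; split=> // c c'; rewrite !inE => Dc Dc'; apply: p'_mono.
    by case/or3P: Dc => [->|/eqP->|->]; rewrite ?orbT.
  by case/or3P: Dc' => [->|/eqP->|->]; rewrite ?orbT.
case/andP: b_hull => /existsP[a0 a0b] /existsP[a1 ba1].
have D_i a : D (i a) by rewrite /D codom_f.
have [||v w /andP[Dv vb] /andP[Dw bw]|r r_pmf [r_ge r_le]] :=
  interpolation S_conn S_acyc S_nobow (I := fun v => D v && (v <= b)%O)
    (J := fun v => D v && (b <= v)%O) (i0 := i a0) (j0 := i a1) p'_pmf.
- by rewrite D_i.
- by rewrite D_i.
- by apply: p'_mono => //; apply: le_trans vb bw.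
exists (fun c => if c == b then r else p' c); split=> [c|a|c c'].
- by case: (c == b).
- by case: eqP => [eq_b|//]; rewrite -eq_b D_i in nDb.
rewrite !inE => Dc Dc' cc'.
have D_of v : (v \in codom i) || ((v == b) || (v \in l)) -> v != b -> D v.
  by move=> Dv /negPf nv; move: Dv; rewrite nv.
case: (eqVneq c b) => [eq_c|nc]; case: (eqVneq c' b) => [eq_c'|nc'].
- by move=> x y _.
- by apply: r_le; rewrite D_of //= -eq_c.
- by apply: r_ge; rewrite D_of //= -eq_c'.
- by apply: p'_mono => //; apply: D_of.
Qed.

Lemma extension_coupling (x0 : S) (p : A -> S -> R) : (forall a, is_pmf (p a)) ->
    (forall a c, (a <= c)%O -> mass_le (p a) (p c)) ->
  monotone_coupling <=%O <=%O p.
Proof.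
move=> p_pmf p_mono.
have [|p' [p'_pmf p'_ext p'_mono]] := extend_system x0 p_pmf p_mono (l := enum in_hull).
  by apply/allP => b; rewrite mem_enum.
pose E := [seq e <- enum {: B * B} | [&& covers e.2 e.1, in_hull e.1 & in_hull e.2]].
have [|e|e|T [q [X [[q_pmf X_law] X_mono]]]] := forest_realizes p'_pmf (E := E) B_acyc.
- by rewrite filter_uniq ?enum_uniq.
- by rewrite mem_filter => /andP[/and3P[]].
- rewrite mem_filter => /andP[/and3P[cov e1 e2] _].
  apply: (mass_le_kernel S_conn S_acyc) => //.
  by apply: p'_mono; rewrite ?mem_enum ?[_ \in in_hull]e1 ?[_ \in in_hull]e2 ?orbT ?ltW ?covers_lt.
exists T, q, (fun a => X (i a)); split=> [//|a s|a c w ac qw]; first by rewrite X_law p'_ext.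
(* The hull is convex, so all covers between [i a] and [i c] belong to [E]. *)
apply: (cover_chain_ind (r := fun u v => X u w <= X v w)%O) => [//|u v t||].
- exact: le_trans.
- move=> u v au vc uv; apply: (X_mono (u, v)) => //.
  rewrite mem_filter mem_enum inE andbT /= uv /in_hull /=.
  have uv_le := ltW (covers_lt uv); apply/andP; split; apply/andP; split; apply/existsP.
  + by exists a.
  + by exists c; apply: le_trans vc.
  + by exists a; apply: le_trans uv_le.
  + by exists c.
by rewrite i_mono.
Qed.

End Sufficiency.

Lemma stochastically_monotone_mass {R : realType} {dA dS : Order.disp_t}
    {A : finPOrderType dA} {S : finPOrderType dS} {x0 : S}
    (P : A -> probability (discrete x0) R) : connected_poset S -> acyclic_poset S ->
  stochastically_monotone P ->
  forall a c, (a <= c)%O -> mass_le (pmf_of (P a)) (pmf_of (P c)).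
Proof.
move=> S_conn S_acyc /stochastically_monotoneP P_mono a c ac x y xy.
by apply: (P_mono a c (side x y) ac) => s t; apply: side_up.
Qed.

Theorem theorem5p1 (R : realType) (dS dA : Order.disp_t)
    (S : finPOrderType dS) (A : finPOrderType dA)
    (S_classY : class_Y S) (A_conn : connected_poset A) :
  monotonicity_equivalence R A S <->
  exists (d : Order.disp_t) (B : finPOrderType d),
    acyclic_poset B /\ has_induced B A.
Proof.
case: S_classY => S_conn S_nB S_Y; split=> [equiv|[d [B [B_acyc /has_induced_embedding[i i_mono]]]]].
  apply: acyclic_extension => obsA; exact: obstruction_not_equivalent S_Y obsA equiv.
have S_acyc : acyclic_poset S by move=> S_cyc; apply: S_nB; split=> //; left.
have S_nobow : ~ has_induced S bowtie by move=> S_bow; apply: S_nB; split=> //; right.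
move=> x0 P P_mono; apply: realizably_monotone_of_coupling.
apply: (extension_coupling S_conn S_acyc S_nobow B_acyc i_mono x0) => [a|].
  exact: pmf_of_pmf.
exact: stochastically_monotone_mass.
Qed.
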